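(* Let $(M,\Lambda,E)$ be a Jacobi manifold, let $a\in C^\infty(M,\mathbb{R})$ be a positive function, and let $(\Lambda_a,E_a)$ be the conformal change of the Jacobi structure $(\Lambda,E)$ by $a$, that is, the Jacobi structure $\Lambda_a=a\Lambda$, $E_a=\#_\Lambda(da)+aE$. Then $$H_k^{LJ}(M,\Lambda,E)\cong H_k^{LJ}(M,\Lambda_a,E_a)\quad\text{for all }k.$$
   Context: Manifolds are smooth and connected. $\Omega^k(M)$ denotes the space of $k$-forms on $M$ (zero for $k<0$). $[\,,\,]$ is the Schouten-Nijenhuis bracket of multivectors, with the convention $[X,f]=X(f)$ for functions $f$, $[X,P]=\mathcal L_XP$ for vector fields $X$, $[P,Q]=(-1)^{pq}[Q,P]$ and $[P,Q\wedge R]=[P,Q]\wedge R+(-1)^{pq+q}Q\wedge[P,R]$ for $P$ a $p$-vector, $Q$ a $q$-vector. A Jacobi structure on $M$ is a pair $(\Lambda,E)$ with $\Lambda$ a $2$-vector and $E$ a vector field such that $[\Lambda,\Lambda]=2E\wedge\Lambda$ and $[E,\Lambda]=0$. For a $1$-form $\alpha$, $\#_\Lambda(\alpha)$ is the vector field defined by $\beta(\#_\Lambda(\alpha))=\Lambda(\alpha,\beta)$ for all 1-forms $\beta$. The Lichnerowicz-Jacobi (LJ) homology $H_*^{LJ}(M,\Lambda,E)$ is the homology of the complex $(\Omega^*(M)\oplus\Omega^{*-1}(M),\delta)$, where $\delta:\Omega^k(M)\oplus\Omega^{k-1}(M)\to\Omega^{k-1}(M)\oplus\Omega^{k-2}(M)$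 is $$\delta(\alpha,\beta)=\big(i(\Lambda)d\alpha-d\,i(\Lambda)\alpha+k\,i_E\alpha+(-1)^k\mathcal L_E\beta,\ \ i(\Lambda)d\beta-d\,i(\Lambda)\beta+(k-1)i_E\beta+(-1)^ki(\Lambda)\alpha\big),$$ which satisfies $\delta^2=0$. Here $i(\Lambda)$ is the contraction by $\Lambda$, with $i(X\wedge Y)\alpha=\alpha(X,Y,\cdot,\dots,\cdot)$. *)

(* Defs.v *)
From HB Require Import structures.
From mathcomp Require Import all_boot all_order all_algebra all_fingroup.
From mathcomp Require Import generic_quotient ring_quotient.
From mathcomp Require Import boolp classical_sets functions reals.
From mathcomp Require Import topology normedtype landau derive.

Set Implicit Arguments.
Unset Strict Implicit.
Unset Printing Implicit Defensive.
Import Order.TTheory GRing.Theory Num.Theory.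
Import numFieldNormedType.Exports.
Local Open Scope classical_set_scope.
Local Open Scope ring_scope.

Section Smoothness.
Context {R : realType} {V W : normedModType R}.

(* [Ck k U f]: f is k times continuously differentiable on the open set U. *)
Fixpoint Ck (k : nat) (U : set V) (f : V -> W) : Prop :=
  match k with
  | 0 => forall x, U x -> {for x, continuous f}
  | k'.+1 => (forall x, U x -> differentiable f x) /\
             (forall v, Ck k' U ('D_v f))
  end.

Definition smooth_on (U : set V) (f : V -> W) : Prop := forall k, Ck k U f.

End Smoothness.

Record chart (R : realType) (n : nat) (M : topologicalType) := Chart {
  chart_dom : set M;
  chart_coord : M -> 'rV[R]_n;
  chart_param : 'rV[R]_n -> M;
  open_dom : open chart_dom;
  open_cod : open (chart_coord @` chart_dom);
  coordK : forall q, chart_dom q -> chart_param (chart_coord q) = q;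
  coord_continuous : forall q, chart_dom q -> {for q, continuous chart_coord};
  param_continuous : forall x, (chart_coord @` chart_dom) x -> {for x, continuous chart_param}
}.

Record manifold (R : realType) (n : nat) := Manifold {
  carrier :> topologicalType;
  carrier_hausdorff : hausdorff_space carrier;
  carrier_second_countable : @second_countable carrier;
  carrier_connected : connected [set: carrier];
  chart_index : Type;
  atlas : chart_index -> chart R n carrier;
  atlas_cover : forall p : carrier, exists i, chart_dom (atlas i) p;
  atlas_smooth : forall i j : chart_index,
    smooth_on (chart_coord (atlas i) @` (chart_dom (atlas i) `&` chart_dom (atlas j)))
              (chart_coord (atlas j) \o chart_param (atlas i))
}.

Section Fields.
Context {R : realType} {n : nat} (M : manifold R n).

Local Notation tangent := 'rV[R]_n.
Local Notation cotangent := 'cV[R]_n.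

(* Each point p comes with a preferred chart [base p] around it, and T_pM is
   identified with R^n through that chart: tangent vectors are rows, covectors
   are columns, and xi evaluates on v to v *m xi. *)
Definition base (p : M) : chart_index M := projT1 (cid (atlas_cover p)).
Definition at_base (p : M) : tangent := chart_coord (atlas (base p)) p.

Definition cod (i : chart_index M) : set 'rV[R]_n :=
  chart_coord (atlas i) @` chart_dom (atlas i).

(* A tangent vector at q with coordinates v in the chart i has coordinates
   v *m jac i j q in the chart j. *)
Definition jac (i j : chart_index M) (q : M) : 'M[R]_n :=
  jacobian (chart_coord (atlas j) \o chart_param (atlas i)) (chart_coord (atlas i) q).

Definition dvec (l : 'I_n) : tangent := delta_mx 0 l.
Definition dcov (l : 'I_n) : cotangent := delta_mx l 0.

Definition is_smooth_function (f : M -> R) : Prop :=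
  forall i, smooth_on (cod i) (f \o chart_param (atlas i) : 'rV[R]_n -> R).

Definition vf_rep (i : chart_index M) (E : M -> tangent) (x : 'rV[R]_n) : tangent :=
  let q := chart_param (atlas i) x in E q *m jac (base q) i q.

Definition is_vector_field (E : M -> tangent) : Prop :=
  forall i l, smooth_on (cod i) (fun x => vf_rep i E x 0 l : R).

(* Forms and multivectors of all degrees are functions of a point and of a list
   of tangent vectors (covectors) there; an object of degree k vanishes on the
   lists of length other than k.  The degree is an integer, so that there are
   only zero forms in negative degree. *)
Definition form_field : lmodType R := M -> seq tangent -> R.
Definition mv_field : lmodType R := M -> seq cotangent -> R.

Definition form_rep (i : chart_index M) (alpha : form_field)
    (x : 'rV[R]_n) (s : seq tangent) : R :=
  let q := chart_param (atlas i) x in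
  alpha q [seq v *m jac i (base q) q | v <- s].

Definition mv_rep (i : chart_index M) (P : mv_field)
    (x : 'rV[R]_n) (s : seq cotangent) : R :=
  let q := chart_param (atlas i) x in
  P q [seq jac (base q) i q *m xi | xi <- s].

Definition of_degree (T : Type) (k : int) (w : seq T -> R) : Prop :=
  forall s, (size s)%:Z != k -> w s = 0.

Definition multilinear (T : lmodType R) (w : seq T -> R) : Prop :=
  forall s1 s2 c u v,
    w (s1 ++ (c *: u + v) :: s2) = c * w (s1 ++ u :: s2) + w (s1 ++ v :: s2).

Definition alternating (T : lmodType R) (w : seq T -> R) : Prop :=
  forall s1 s2 s3 u, w (s1 ++ u :: s2 ++ u :: s3) = 0.

Definition is_form (k : int) (alpha : form_field) : Prop :=
  [/\ forall p, of_degree k (alpha p), forall p, multilinear (alpha p),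
      forall p, alternating (alpha p)
    & forall i s, smooth_on (cod i) (form_rep i alpha ^~ s)].

Definition is_multivector (k : int) (P : mv_field) : Prop :=
  [/\ forall p, of_degree k (P p), forall p, multilinear (P p),
      forall p, alternating (P p)
    & forall i s, smooth_on (cod i) (mv_rep i P ^~ s)].

Definition form_of_fun (f : M -> R) : form_field :=
  fun p s => if s is [::] then f p else 0.

Definition mv_of_vf (E : M -> tangent) : mv_field :=
  fun p s => if s is [:: xi] then (E p *m xi) 0 0 else 0.

Definition omit_nth (T : Type) (j : nat) (s : seq T) : seq T :=
  take j s ++ drop j.+1 s.

(* (d alpha)(v_0, .., v_k) = \sum_j (-1)^j D_(v_j) alpha(.., omit v_j, ..) for
   constant v_0, .., v_k, computed in the preferred chart of the point. *)
Definition ext_d (alpha : form_field) : form_field := fun p s =>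
  \sum_(j < size s) (-1) ^+ j *
    'D_(nth 0 s j) (form_rep (base p) alpha ^~ (omit_nth j s)) (at_base p).

Definition contr_vf (E : M -> tangent) (alpha : form_field) : form_field :=
  fun p s => alpha p (E p :: s).

(* With L = 2^-1 \sum_(a, b) L(dx^a, dx^b) (d/dx^a) /\ (d/dx^b), this is the
   linear extension of i(X /\ Y) alpha = alpha(X, Y, ..). *)
Definition contr_bv (L : mv_field) (alpha : form_field) : form_field :=
  fun p s => 2^-1 * \sum_(a < n) \sum_(b < n)
    L p [:: dcov a; dcov b] * alpha p [:: dvec a, dvec b & s].

(* Cartan's formula. *)
Definition lie_d (E : M -> tangent) (alpha : form_field) : form_field :=
  contr_vf E (ext_d alpha) + ext_d (contr_vf E alpha).

Definition covector_at (alpha : form_field) (p : M) : cotangent :=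
  \col_l alpha p [:: dvec l].

(* beta(sharp L alpha) = L(alpha, beta) for all 1-forms beta, see sharpP. *)
Definition sharp (L : mv_field) (alpha : form_field) : M -> tangent :=
  fun p => \row_l L p [:: covector_at alpha p; dcov l].

(* Wedge of a p-vector and a q-vector, normalized so that
   (X /\ Y)(xi, eta) = xi(X) eta(Y) - xi(Y) eta(X). *)
Definition wedge (p q : nat) (P Q : mv_field) : mv_field := fun pt s =>
  (p`! * q`!)%:R^-1 * \sum_(sigma : 'S_(size s))
    let t := [seq nth 0 s (sigma i) | i <- enum 'I_(size s)] in
    (-1) ^+ sigma * P pt (take p t) * Q pt (drop p t).

Definition mv_partial (l : 'I_n) (P : mv_field) : mv_field := fun p s =>
  'D_(dvec l) (mv_rep (base p) P ^~ s) (at_base p).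

Definition mv_contr (l : 'I_n) (P : mv_field) : mv_field := fun p s =>
  P p (dcov l :: s).

(* The Schouten-Nijenhuis bracket of a p-vector and a q-vector in coordinates:
   the only bracket with [X, f] = X(f), [X, Y] the Lie bracket,
   [P, Q] = (-1)^(pq) [Q, P] and
   [P, Q /\ S] = [P, Q] /\ S + (-1)^(pq + q) Q /\ [P, S]. *)
Definition schouten (p q : nat) (P Q : mv_field) : mv_field :=
  \sum_(l < n) (wedge p.-1 q (mv_contr l P) (mv_partial l Q)
    + (-1) ^+ (p * q) *: wedge q.-1 p (mv_contr l Q) (mv_partial l P)).

Definition is_jacobi (L : mv_field) (E : M -> tangent) : Prop :=
  schouten 2 2 L L = 2 *: wedge 1 2 (mv_of_vf E) L /\
  schouten 1 2 (mv_of_vf E) L = 0.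

Definition conformal_bv (a : M -> R) (L : mv_field) : mv_field :=
  fun p s => a p * L p s.

Definition conformal_vf (a : M -> R) (L : mv_field) (E : M -> tangent) :
    M -> tangent :=
  fun p => sharp L (ext_d (form_of_fun a)) p + a p *: E p.

Definition LJ_chain (k : int) (c : form_field * form_field) : Prop :=
  is_form k c.1 /\ is_form (k - 1) c.2.

Definition LJ_delta (L : mv_field) (E : M -> tangent) (k : int)
    (c : form_field * form_field) : form_field * form_field :=
  (contr_bv L (ext_d c.1) - ext_d (contr_bv L c.1)
     + k%:~R *: contr_vf E c.1 + (-1) ^ k *: lie_d E c.2,
   contr_bv L (ext_d c.2) - ext_d (contr_bv L c.2)
     + (k - 1)%:~R *: contr_vf E c.2 + (-1) ^ k *: contr_bv L c.1).

End Fields.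

Section SmoothnessTheory.
Context {R : realType} {V : normedModType R}.

Lemma near_eq_differentiable (W : normedModType R) (f g : V -> W) (x : V) :
  (\near x, f x = g x) -> differentiable f x -> differentiable g x.
Proof.
move=> fg df; have fgx : f x = g x by exact: nbhs_singleton fg.
move/diff_locallyP: (df) => [dfc dfE].
have gE : g \o shift x = cst (g x) + 'd f x +o_ 0 id.
  apply/eqaddoP => e e0.
  move/eqaddoP : dfE => /(_ e e0) dfE.
  have fg0 : \forall h \near 0, f (h + x) = g (h + x).
    by move/nbhs0P : fg; apply: filterS => h; rewrite addrC.
  near=> h; rewrite -fgx.
  have : f (h + x) = g (h + x) by near: h.
  have : `|(f \o shift x - (cst (f x) + 'd f x)) h| <= e * `|id h| by near: h.
  by rewrite !fctE /= => + <-.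
have dg : 'd g x = 'd f x :> (V -> W) by exact: diff_unique.
by apply/diff_locallyP; rewrite dg.
Unshelve. all: by end_near. Qed.

Lemma open_near (U : set V) (P : V -> Prop) (x : V) :
  open U -> U x -> (forall y, U y -> P y) -> \near x, P x.
Proof. by move=> oU Ux UP; apply: filterS UP _; exact: open_nbhs_nbhs. Qed.

Lemma Ck_ext (W : normedModType R) (k : nat) (U : set V) (f g : V -> W) :
  open U -> (forall x, U x -> f x = g x) -> Ck k U f -> Ck k U g.
Proof.
move=> oU; elim: k f g => [|k IH] f g fg /=.
  move=> fc x Ux; have fgx : {near x, f =1 g}.
    exact: open_near Ux _.
  rewrite /prop_for /continuous_at -(fg _ Ux).
  by apply: cvg_trans (fc x Ux); apply: near_eq_cvg; exact: fgx.
case=> df ck; split=> [x Ux|v].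
  by apply: near_eq_differentiable (df x Ux); apply: open_near Ux _.
apply: IH (ck v) => x Ux; apply: near_eq_derive.
exact: open_near Ux _.
Qed.

Lemma CkW (W : normedModType R) (k : nat) (U : set V) (f : V -> W) :
  Ck k.+1 U f -> Ck k U f.
Proof.
elim: k f => [|k IH] f /= [df ck].
  by move=> x Ux; exact/differentiable_continuous/df.
by split=> // v; apply: IH; exact: ck.
Qed.

Lemma Ck_lin (W : normedModType R) (k : nat) (U : set V) (c : R) (f g : V -> W) :
  open U -> Ck k U f -> Ck k U g -> Ck k U (fun x => c *: f x + g x).
Proof.
move=> oU; elim: k f g => [|k IH] f g /=.
  by move=> fc gc x Ux; apply: cvgD (gc x Ux); apply: cvgZl_tmp; exact: fc.
move=> [df cf] [dg cg]; split=> [x Ux|v].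
  by apply: differentiableD (dg x Ux); apply: differentiableZ; exact: df.
apply: Ck_ext (IH _ _ (cf v) (cg v)) => // x Ux.
have dfx : derivable f x v by exact/diff_derivable/df.
have dgx : derivable g x v by exact/diff_derivable/dg.
have -> : (fun x => c *: f x + g x) = c \*: f + g by [].
by rewrite deriveD ?deriveZ //; exact: derivableZ.
Qed.

Lemma Ck_cst (W : normedModType R) (k : nat) (U : set V) (w : W) :
  Ck k U (cst w).
Proof.
elim: k w => [|k IH] w /=; first by move=> x _; exact: cvg_cst.
split=> [x _|v]; first exact: differentiable_cst.
by have -> : 'D_v (cst w) = cst 0 :> (V -> W) by apply/funext => x; exact: derive_cst.
Qed.

Lemma CkM (k : nat) (U : set V) (f g : V -> R) :
  open U -> Ck k U f -> Ck k U g -> Ck k U (fun x => f x * g x).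
Proof.
move=> oU; elim: k f g => [|k IH] f g.
  by move=> /= fc gc x Ux; apply: cvgM; [exact: fc|exact: gc].
move=> f1 g1; have [df cf] := f1; have [dg cg] := g1; split=> [x Ux|v].
  by apply: differentiableM; [exact: df|exact: dg].
apply: (@Ck_ext _ _ _ (fun x => 1 *: (f x * 'D_v g x) + g x * 'D_v f x)) => //.
  move=> x Ux.
  have -> : (fun x => f x * g x) = f * g by [].
  by rewrite deriveM ?scale1r //; apply: diff_derivable; [exact: df|exact: dg].
by apply: Ck_lin => //; apply: IH; by [exact: CkW|exact: cf|exact: cg].
Qed.

Lemma Ck_sum (W : normedModType R) (k m : nat) (U : set V) (f : 'I_m -> V -> W) :
  open U -> (forall i, Ck k U (f i)) -> Ck k U (fun x => \sum_(i < m) f i x).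
Proof.
move=> oU; elim: m f => [|m IH] f cf.
  by apply: Ck_ext (Ck_cst k U (0 : W)) => // x _; rewrite big_ord0.
apply: Ck_ext (Ck_lin 1 oU (IH _ (fun i => cf (widen_ord (leqnSn m) i))) (cf ord_max)) => //.
by move=> x _; rewrite big_ord_recr /= scale1r.
Qed.

Lemma smooth_ext (W : normedModType R) (U : set V) (f g : V -> W) :
  open U -> (forall x, U x -> f x = g x) -> smooth_on U f -> smooth_on U g.
Proof. by move=> oU fg cf k; exact: Ck_ext (cf k). Qed.

Lemma smooth_lin (W : normedModType R) (U : set V) (c : R) (f g : V -> W) :
  open U -> smooth_on U f -> smooth_on U g ->
  smooth_on U (fun x => c *: f x + g x).
Proof. by move=> oU cf cg k; exact: Ck_lin. Qed.

Lemma smooth_mul (U : set V) (f g : V -> R) :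
  open U -> smooth_on U f -> smooth_on U g -> smooth_on U (fun x => f x * g x).
Proof. by move=> oU cf cg k; exact: CkM. Qed.

Lemma smooth_sum (W : normedModType R) (m : nat) (U : set V) (f : 'I_m -> V -> W) :
  open U -> (forall i, smooth_on U (f i)) ->
  smooth_on U (fun x => \sum_(i < m) f i x).
Proof. by move=> oU cf k; apply: Ck_sum => // i; exact: cf. Qed.

Lemma smooth_cst (W : normedModType R) (U : set V) (w : W) : smooth_on U (cst w).
Proof. by move=> k; exact: Ck_cst. Qed.

Lemma smooth_derive (W : normedModType R) (U : set V) (f : V -> W) (v : V) :
  smooth_on U f -> smooth_on U ('D_v f).
Proof. by move=> cf k; have [_] := cf k.+1; exact. Qed.

Lemma smooth_differentiable (W : normedModType R) (U : set V) (f : V -> W) x :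
  smooth_on U f -> U x -> differentiable f x.
Proof. by move=> cf; have [+ _] := cf 1; exact. Qed.

End SmoothnessTheory.

Section ManifoldTheory.
Context {R : realType} {n : nat} (M : manifold R n).
Implicit Types (i j k : chart_index M) (p q : M) (x v : 'rV[R]_n).

Lemma base_dom p : chart_dom (atlas (base p)) p.
Proof. by rewrite /base; case: cid. Qed.

Lemma cod_open i : open (cod i).
Proof. exact: open_cod. Qed.

Lemma cod_coord i q : chart_dom (atlas i) q -> cod i (chart_coord (atlas i) q).
Proof. by move=> iq; exists q. Qed.

Lemma param_dom i x : cod i x -> chart_dom (atlas i) (chart_param (atlas i) x).
Proof. by case=> q iq <-; rewrite coordK. Qed.

Lemma paramK i x : cod i x -> chart_coord (atlas i) (chart_param (atlas i) x) = x.
Proof. by case=> q iq <-; rewrite coordK. Qed.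

Lemma near_param i j q : chart_dom (atlas i) q -> chart_dom (atlas j) q ->
  \forall x \near chart_coord (atlas i) q,
    cod i x /\ chart_dom (atlas j) (chart_param (atlas i) x).
Proof.
move=> iq jq; have cq := cod_coord iq.
apply: filterI; first by apply: open_nbhs_nbhs; split; [exact: cod_open|].
have := param_continuous cq; rewrite /prop_for /continuous_at coordK //; apply.
exact: open_nbhs_nbhs (conj (open_dom _) jq).
Qed.

Lemma transition_differentiable i j q :
  chart_dom (atlas i) q -> chart_dom (atlas j) q ->
  differentiable (chart_coord (atlas j) \o chart_param (atlas i))
    (chart_coord (atlas i) q).
Proof.
by move=> iq jq; apply: smooth_differentiable (atlas_smooth i j) _; exists q.
Qed.

Lemma mul_jac i j q v : chart_dom (atlas i) q -> chart_dom (atlas j) q ->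
  v *m jac i j q =
  'D_v (chart_coord (atlas j) \o chart_param (atlas i)) (chart_coord (atlas i) q).
Proof. by move=> iq jq; rewrite deriveEjacobian //; exact: transition_differentiable. Qed.

Lemma derive_change_chart (W : normedModType R) (f : M -> W) i j q v :
  chart_dom (atlas i) q -> chart_dom (atlas j) q ->
  differentiable (f \o chart_param (atlas j)) (chart_coord (atlas j) q) ->
  'D_v (f \o chart_param (atlas i)) (chart_coord (atlas i) q) =
  'D_(v *m jac i j q) (f \o chart_param (atlas j)) (chart_coord (atlas j) q).
Proof.
move=> iq jq df; have dt := transition_differentiable iq jq.
have tq : (chart_coord (atlas j) \o chart_param (atlas i))
    (chart_coord (atlas i) q) = chart_coord (atlas j) q by rewrite /= coordK.
rewrite -tq in df *.
transitivity ('D_v ((f \o chart_param (atlas j)) \o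
    (chart_coord (atlas j) \o chart_param (atlas i))) (chart_coord (atlas i) q)).
  apply: near_eq_derive; apply: filterS (near_param iq jq) => x /= [_ jx].
  by rewrite coordK.
rewrite deriveE; last exact: differentiable_comp.
by rewrite diff_comp //= deriveE // mul_jac // deriveE.
Qed.

Lemma mulmx_rV_inj m (A B : 'M[R]_(n, m)) :
  (forall v : 'rV_n, v *m A = v *m B) -> A = B.
Proof. by move=> AB; apply/row_matrixP => l; rewrite !rowE AB. Qed.

Lemma jac_comp i j k q : chart_dom (atlas i) q -> chart_dom (atlas j) q ->
  chart_dom (atlas k) q -> jac i j q *m jac j k q = jac i k q.
Proof.
move=> iq jq kq; apply: mulmx_rV_inj => v.
rewrite mulmxA.
rewrite (mul_jac _ jq kq).
rewrite [RHS](mul_jac _ iq kq).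
by rewrite (derive_change_chart _ iq jq) //; exact: transition_differentiable.
Qed.

Lemma jac_id i q : chart_dom (atlas i) q -> jac i i q = 1%:M.
Proof.
move=> iq; apply: mulmx_rV_inj => v.
rewrite mul_jac // mulmx1 -[RHS](derive_id (chart_coord (atlas i) q) v).
by apply: near_eq_derive; apply: filterS (near_param iq iq) => x [/paramK].
Qed.

Lemma jacK i j q : chart_dom (atlas i) q -> chart_dom (atlas j) q ->
  jac i j q *m jac j i q = 1%:M.
Proof. by move=> iq jq; rewrite jac_comp // jac_id. Qed.

End ManifoldTheory.

Section Linearity.
Context {R : realType}.

Definition lin_fun (T : lmodType R) (f : T -> R) : Prop :=
  forall c u v, f (c *: u + v) = c * f u + f v.

Lemma lin_fun_sum (T : lmodType R) (f : T -> R) m (c : 'I_m -> R) (u : 'I_m -> T) :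
  lin_fun f -> f (\sum_(l < m) c l *: u l) = \sum_(l < m) c l * f (u l).
Proof.
move=> lf; have f0 : f 0 = 0.
  have := lf 1 0 0; rewrite scaler0 addr0 mul1r => f00.
  by apply: (@addrI _ (f 0)); rewrite -f00 addr0.
by elim/big_rec2 : _ => // l y1 y2 _ <-; rewrite lf.
Qed.

Lemma row_dvec n (v : 'rV[R]_n) : v = \sum_(l < n) v 0 l *: dvec l.
Proof. exact: row_sum_delta. Qed.

Lemma col_dcov n (xi : 'cV[R]_n) : xi = \sum_(l < n) xi l 0 *: dcov l.
Proof.
apply: trmx_inj; rewrite [LHS]row_sum_delta raddf_sum /=; apply: eq_bigr => l _.
by rewrite linearZ /= trmx_delta mxE.
Qed.

Lemma lin_fun_pairing n (f : 'cV[R]_n -> R) (g : 'rV[R]_n -> R) (A B : 'M[R]_n) :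
  lin_fun f -> lin_fun g -> B *m A = 1%:M ->
  \sum_(k < n) f (B *m dcov k) * g (dvec k *m A) =
  \sum_(l < n) f (dcov l) * g (dvec l).
Proof.
move=> lf lg BA.
transitivity (\sum_(k < n) \sum_(l < n) A k l * f (B *m dcov k) * g (dvec l)).
  apply: eq_bigr => k _; rewrite [X in g X]row_dvec lin_fun_sum // mulr_sumr.
  by apply: eq_bigr => l _; rewrite -rowE mxE mulrCA mulrA.
rewrite exchange_big /=; apply: eq_bigr => l _; rewrite -mulr_suml; congr (_ * _).
rewrite -(lin_fun_sum (A ^~ l) _ lf); congr f.
rewrite -[RHS]mul1mx -BA -mulmxA [X in B *m X]col_dcov mulmx_sumr.
by apply: eq_bigr => k _; rewrite -scalemxAr -[A *m _]colE mxE.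
Qed.

End Linearity.

Section FieldTheory.
Context {R : realType} {n : nat} (M : manifold R n).
Implicit Types (i : chart_index M) (x : 'rV[R]_n) (s : seq 'rV[R]_n).
Implicit Types (alpha beta : form_field M) (L : mv_field M) (E : M -> 'rV[R]_n).

Lemma form_rep_multilinear i alpha x :
  (forall p, multilinear (alpha p)) -> multilinear (form_rep i alpha x).
Proof.
move=> ml s1 s2 c u v.
by rewrite /form_rep !map_cat /= mulmxDl -scalemxAl ml.
Qed.

Lemma mv_rep_multilinear i L x :
  (forall p, multilinear (L p)) -> multilinear (mv_rep i L x).
Proof.
move=> ml s1 s2 c u v.
by rewrite /mv_rep !map_cat /= mulmxDr -scalemxAr ml.
Qed.

Lemma form_rep_contr_vf i E alpha x s :
  (forall p, multilinear (alpha p)) -> cod i x ->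
  form_rep i (contr_vf E alpha) x s =
  \sum_(l < n) vf_rep i E x 0 l * form_rep i alpha x (dvec l :: s).
Proof.
move=> ml cx; have iq := param_dom cx; set q := chart_param (atlas i) x in iq.
have lf : lin_fun (fun v => form_rep i alpha x (v :: s)).
  by move=> c u v; have := form_rep_multilinear i x ml [::] s c u v.
rewrite -(lin_fun_sum _ _ lf) -row_dvec /form_rep /contr_vf /vf_rep /= -/q.
by rewrite -mulmxA jacK ?mulmx1 //; exact: base_dom.
Qed.

Lemma form_rep_contr_bv i L alpha x s :
  (forall p, multilinear (L p)) -> (forall p, multilinear (alpha p)) -> cod i x ->
  form_rep i (contr_bv L alpha) x s =
  2^-1 * \sum_(a < n) \sum_(b < n) mv_rep i L x [:: dcov a; dcov b] *
    form_rep i alpha x [:: dvec a, dvec b & s].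
Proof.
move=> mL ml cx; have iq := param_dom cx.
rewrite /form_rep /contr_bv /mv_rep /=; set q := chart_param (atlas i) x in iq *.
set t := [seq _ | v <- s]; congr (_ * _).
have BA : jac (base q) i q *m jac i (base q) q = 1%:M.
  by rewrite jacK //; exact: base_dom.
move: (jac i (base q) q) (jac (base q) i q) BA => A B BA.
transitivity (\sum_(a < n) \sum_(b < n)
    L q [:: dcov a; B *m dcov b] * alpha q [:: dvec a, dvec b *m A & t]).
  apply: eq_bigr => a _.
  rewrite (@lin_fun_pairing _ _ (fun xi => L q [:: dcov a; xi])
    (fun v => alpha q [:: dvec a, v & t])) //.
    by move=> c u v; exact: (mL q [:: dcov a] [::]).
  by move=> c u v; exact: (ml q [:: dvec a] t).
rewrite exchange_big [RHS]exchange_big /=; apply: eq_bigr => b _.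
rewrite (@lin_fun_pairing _ _ (fun xi => L q [:: xi; B *m dcov b])
  (fun v => alpha q [:: v, dvec b *m A & t])) //.
  by move=> c u v; exact: (mL q [::] [:: B *m dcov b]).
by move=> c u v; exact: (ml q [::] (dvec b *m A :: t)).
Qed.

Definition rep_smooth alpha : Prop :=
  forall i s, smooth_on (cod i) (form_rep i alpha ^~ s).

Lemma smooth_contr_vf k E alpha :
  is_vector_field E -> is_form k alpha -> rep_smooth (contr_vf E alpha).
Proof.
move=> sE [_ ml _ sa] i s; have oi := @cod_open _ _ M i.
apply: (smooth_ext oi (fun x cx => esym (form_rep_contr_vf E s ml cx))).
by apply: smooth_sum => // l; apply: smooth_mul.
Qed.

Lemma smooth_contr_bv k L alpha :
  is_multivector 2 L -> is_form k alpha -> rep_smooth (contr_bv L alpha).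
Proof.
move=> [_ mL _ sL] [_ ml _ sa] i s; have oi := @cod_open _ _ M i.
apply: (smooth_ext oi (fun x cx => esym (form_rep_contr_bv s mL ml cx))).
apply: smooth_mul => //; first exact: smooth_cst.
apply: smooth_sum => // a; apply: smooth_sum => // b.
by apply: smooth_mul.
Qed.

Lemma ext_d_lin c alpha beta : rep_smooth alpha -> rep_smooth beta ->
  ext_d (c *: alpha + beta) = c *: ext_d alpha + ext_d beta.
Proof.
move=> sa sb; apply/funext => p; apply/funext => s.
rewrite /ext_d !fctE /= /ext_d scaler_sumr -big_split /=; apply: eq_bigr => j _.
have cp : cod (base p) (at_base p) by apply: cod_coord; exact: base_dom.
set v := nth 0 s j; set t := omit_nth j s.
have da : derivable (form_rep (base p) alpha ^~ t) (at_base p) v.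
  by apply: diff_derivable; exact: smooth_differentiable (sa _ _) cp.
have db : derivable (form_rep (base p) beta ^~ t) (at_base p) v.
  by apply: diff_derivable; exact: smooth_differentiable (sb _ _) cp.
have -> : (form_rep (base p) (c *: alpha + beta))^~ t =
    c \*: (form_rep (base p) alpha ^~ t) + (form_rep (base p) beta ^~ t) by [].
rewrite deriveD ?deriveZ //; last exact: derivableZ.
by rewrite mulrDr; congr (_ + _); exact: mulrCA.
Qed.

Lemma contr_vf_lin E c alpha beta :
  contr_vf E (c *: alpha + beta) = c *: contr_vf E alpha + contr_vf E beta.
Proof. by []. Qed.

Lemma contr_bv_lin L c alpha beta :
  contr_bv L (c *: alpha + beta) = c *: contr_bv L alpha + contr_bv L beta.
Proof.
apply/funext => p; apply/funext => s; rewrite /contr_bv !fctE /=.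
have fac (y z : R) : c *: (2^-1 * y) + 2^-1 * z = 2^-1 * (c * y + z).
  by rewrite mulrDr [2^-1 * (c * y)]mulrCA.
rewrite [RHS]fac; congr (_ * _); rewrite mulr_sumr -big_split /=.
apply: eq_bigr => a _; rewrite mulr_sumr -big_split /=; apply: eq_bigr => b _.
by rewrite mulrDr; congr (_ + _); exact: mulrCA.
Qed.

Lemma is_form0 k : is_form k (0 : form_field M).
Proof.
split=> //; first by move=> p s1 s2 c u v; rewrite -[RHS]/(c * 0 + 0 : R) mulr0 addr0.
by move=> i s; exact: smooth_cst.
Qed.

Lemma is_form_lin k c alpha beta :
  is_form k alpha -> is_form k beta -> is_form k (c *: alpha + beta).
Proof.
move=> [da ma aa sa] [db mb ab sb]; split.
- by move=> p s ks; rewrite !fctE da // db // scaler0 addr0.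
- move=> p s1 s2 d u v; rewrite !fctE ma mb scalerDr mulrDr -!addrA; congr (_ + _).
    exact: mulrCA.
  by rewrite addrCA.
- by move=> p s1 s2 s3 u; rewrite !fctE aa ab scaler0 addr0.
- by move=> i s; apply: smooth_lin (sa i s) (sb i s); exact: cod_open.
Qed.

Fact sharpP L alpha beta p :
  (forall p, multilinear (L p)) -> (forall p, multilinear (beta p)) ->
  beta p [:: sharp L alpha p] = L p [:: covector_at alpha p; covector_at beta p].
Proof.
move=> mL mb.
have lb : lin_fun (fun v => beta p [:: v]).
  by move=> c u v; exact: (mb p [::] [::] c u v).
have lL : lin_fun (fun xi => L p [:: covector_at alpha p; xi]).
  by move=> c u v; exact: (mL p [:: covector_at alpha p] [::] c u v).
rewrite [sharp _ _ _]row_dvec (lin_fun_sum _ _ lb).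
rewrite [covector_at beta p]col_dcov (lin_fun_sum _ _ lL).
by apply: eq_bigr => l _; rewrite !mxE mulrC.
Qed.

End FieldTheory.

Section LmodQuotient.
Context {R : pzRingType} {V : lmodType R} {S : {pred V}}
  (S_closed : submod_closed S).
Local Open Scope quotient_scope.

Definition submod_of of submod_closed S : V -> bool := fun v => v \in S.
Local Notation I := (submod_of S_closed).

Fact submod_of_closed : submod_closed I.
Proof. by []. Qed.

HB.instance Definition _ := GRing.isSubmodClosed.Build R V I submod_of_closed.

Definition lmod_quot : Type := Quotient.quot (GRing.ZmodClosed.clone V I _).
HB.instance Definition _ := ZmodQuotient.on lmod_quot.

Definition quot_scale (c : R) (x : lmod_quot) : lmod_quot :=
  \pi_lmod_quot (c *: repr x).

Fact quot_scale_pi c v : quot_scale c (\pi_lmod_quot v) = \pi_lmod_quot (c *: v).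
Proof.
apply/eqP; rewrite -Quotient.idealrBE -scalerBr rpredZ //.
rewrite Quotient.idealrBE.
apply/eqP; exact: reprK.
Qed.

Fact quot_scaleA c d x : quot_scale c (quot_scale d x) = quot_scale (c * d) x.
Proof. by rewrite -[x]reprK (quot_scale_pi d) !quot_scale_pi scalerA. Qed.

Fact quot_scale1 : left_id 1 quot_scale.
Proof. by move=> x; rewrite -[x]reprK quot_scale_pi scale1r. Qed.

Fact quot_scaleDr : right_distributive quot_scale +%R.
Proof.
move=> c x y; rewrite -[x]reprK -[y]reprK.
by rewrite -raddfD !quot_scale_pi -raddfD scalerDr.
Qed.

Fact quot_scaleDl x : {morph quot_scale^~ x : c d / c + d}.
Proof. by move=> c d; rewrite -[x]reprK !quot_scale_pi -raddfD scalerDl. Qed.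

HB.instance Definition _ := GRing.Zmodule_isLmodule.Build R lmod_quot
  quot_scaleA quot_scale1 quot_scaleDr quot_scaleDl.

HB.instance Definition _ := GRing.isScalable.Build R V lmod_quot *:%R
  \pi_lmod_quot (fun c v => esym (quot_scale_pi c v)).

End LmodQuotient.

Section Bundles.
Context {R : realType} {n : nat} (M : manifold R n).

Record smooth_function := SmoothFunction {
  function_of :> M -> R;
  smooth_functionP : is_smooth_function function_of
}.

Record vector_field := VectorField {
  vector_of :> M -> 'rV[R]_n;
  vector_fieldP : is_vector_field vector_of
}.

Record bivector := Bivector {
  bivector_of :> mv_field M;
  bivectorP : is_multivector 2 bivector_of
}.

End Bundles.

Section Homology.
Context {R : realType} {n : nat} {M : manifold R n}
  (L : bivector M) (E : vector_field M) (k : int).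

Fact LJ_chain_lin c (x y : form_field M * form_field M) :
  LJ_chain k x -> LJ_chain k y -> LJ_chain k (c *: x + y).
Proof. by move=> [x1 x2] [y1 y2]; split; rewrite /=; exact: is_form_lin. Qed.

Fact LJ_delta_lin c (x y : form_field M * form_field M) :
  LJ_chain k x -> LJ_chain k y ->
  LJ_delta L E k (c *: x + y) = c *: LJ_delta L E k x + LJ_delta L E k y.
Proof.
have linB (V : lmodType R) (a b a' b' : V) :
    (c *: a + a') - (c *: b + b') = c *: (a - b) + (a' - b').
  by rewrite scalerBr opprD addrACA.
have linD (V : lmodType R) (a b a' b' : V) :
    (c *: a + a') + (c *: b + b') = c *: (a + b) + (a' + b').
  by rewrite scalerDr addrACA.
have linZ (V : lmodType R) d (a b : V) : d *: (c *: a + b) = c *: (d *: a) + d *: b.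
  by rewrite scalerDr !scalerA mulrC.
case: x y => [x1 x2] [y1 y2] [/= fx1 fx2] [/= fy1 fy2].
have sL := bivectorP L; have sE := vector_fieldP E.
have rs a m : is_form m a -> rep_smooth a by move=> [].
rewrite /LJ_delta /lie_d /=.
rewrite !(contr_vf_lin, contr_bv_lin, ext_d_lin);
  try by [exact: rs fx1|exact: rs fx2|exact: rs fy1|exact: rs fy2
    |exact: smooth_contr_bv fx1|exact: smooth_contr_bv fx2
    |exact: smooth_contr_bv fy1|exact: smooth_contr_bv fy2
    |exact: smooth_contr_vf fx2|exact: smooth_contr_vf fy2].
rewrite ?(contr_bv_lin, contr_vf_lin).
by rewrite !(linB, linD, linZ).
Qed.

Definition LJ_cycles : {pred form_field M * form_field M} :=
  fun c => `[< LJ_chain k c /\ LJ_delta L E k c = 0 >].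

Fact LJ_cycles_closed : submod_closed LJ_cycles.
Proof.
have d0 : LJ_chain k (0 : form_field M * form_field M) by split; exact: is_form0.
split=> [|c x y /asboolP[cx dx] /asboolP[cy dy]]; apply/asboolP; split=> //.
- have := LJ_delta_lin 0 d0 d0; rewrite !scale0r !add0r => e.
  have := LJ_delta_lin 1 d0 d0; rewrite !scale1r !addr0 => e'.
  by apply: (@addrI _ (LJ_delta L E k 0)); rewrite -e' addr0.
- exact: LJ_chain_lin.
- by rewrite LJ_delta_lin // dx dy scaler0 addr0.
Qed.

HB.instance Definition _ := GRing.isSubmodClosed.Build R
  (form_field M * form_field M)%type LJ_cycles LJ_cycles_closed.

Record LJ_cycle := LJCycle {
  cycle_val : form_field M * form_field M;
  cycle_valP : cycle_val \in LJ_cycles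
}.

HB.instance Definition _ := [isSub for cycle_val].
HB.instance Definition _ := [Choice of LJ_cycle by <:].
HB.instance Definition _ := [SubChoice_isSubLmodule of LJ_cycle by <:].

End Homology.

Section HomologyQuotient.
Context {R : realType} {n : nat} {M : manifold R n}
  (L : bivector M) (E : vector_field M) (k : int).

(* The cycles that are the delta of a chain of degree k + 1.  That delta maps
   chains to chains and squares to zero is not needed to form the quotient. *)
Definition LJ_boundaries : {pred LJ_cycle L E k} := fun z =>
  `[< exists2 c, LJ_chain (k + 1) c & LJ_delta L E (k + 1) c = cycle_val z >].

Fact LJ_boundaries_closed : submod_closed LJ_boundaries.
Proof.
split=> [|c x y /asboolP[x' cx dx] /asboolP[y' cy dy]]; apply/asboolP.
  have /asboolP[c0 d0] := (LJ_cycles_closed L E (k + 1)).1.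
  by exists 0.
exists (c *: x' + y'); first exact: LJ_chain_lin.
by rewrite LJ_delta_lin // dx dy.
Qed.

Definition LJ_homology : lmodType R := lmod_quot LJ_boundaries_closed.

End HomologyQuotient.

Definition lmod_isomorphic (R : pzRingType) (V W : lmodType R) : Prop :=
  exists f : {linear V -> W}, bijective f.

Section ConformalChange.
Context {R : realType} {n : nat} {M : manifold R n}
  (a : smooth_function M) (L : bivector M) (E : vector_field M).

Fact conformal_bvP : is_multivector 2 (conformal_bv a L).
Proof.
have [dL mL aL sL] := bivectorP L; rewrite /conformal_bv; split.
- by move=> p s sz; rewrite dL ?mulr0.
- by move=> p s1 s2 c u v; rewrite mL mulrDr mulrCA.
- by move=> p s1 s2 s3 u; rewrite aL mulr0.
move=> i s; apply: smooth_mul; first exact: open_cod.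
  exact: smooth_functionP.
exact: sL.
Qed.

Fact ext_d_fun1 p v :
  ext_d (form_of_fun a) p [:: v] =
  'D_v (a \o chart_param (atlas (base p))) (at_base p).
Proof. by rewrite /ext_d big_ord1 expr0 mul1r. Qed.

Fact covector_at_ext_d i q : chart_dom (atlas i) q ->
  covector_at (ext_d (form_of_fun a)) q = jac (base q) i q *m
    \col_m 'D_(dvec m) (a \o chart_param (atlas i)) (chart_coord (atlas i) q).
Proof.
move=> iq; apply/colP => l; rewrite !mxE ext_d_fun1.
have da : differentiable (a \o chart_param (atlas i)) (chart_coord (atlas i) q).
  exact: smooth_differentiable (smooth_functionP a i) (cod_coord iq).
rewrite (derive_change_chart _ (base_dom q) iq) // deriveE //.
rewrite [dvec l *m _]row_dvec linear_sum; apply: eq_bigr => m _.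
by rewrite linearZ /= -rowE !mxE deriveE.
Qed.

Fact vf_rep_conformal i x l : cod i x ->
  vf_rep i (conformal_vf a L E) x 0 l =
  1 *: (\sum_(m < n) 'D_(dvec m) (a \o chart_param (atlas i)) x *
         mv_rep i L x [:: dcov m; dcov l])
  + a (chart_param (atlas i) x) * vf_rep i E x 0 l.
Proof.
move=> cx; have iq := param_dom cx; have [_ mL _ _] := bivectorP L.
rewrite /vf_rep /conformal_vf mulmxDl -scalemxAl mxE scale1r; congr (_ + _); last first.
  by rewrite mxE.
set q := chart_param (atlas i) x in iq *.
have lin1 : lin_fun (fun xi => mv_rep i L x [:: xi; dcov l]).
  by move=> c u v; have := mv_rep_multilinear i x mL [::] [:: dcov l] c u v.
pose D : 'cV[R]_n :=
  \col_m 'D_(dvec m) (a \o chart_param (atlas i)) x.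
have covE : covector_at (ext_d (form_of_fun a)) q = jac (base q) i q *m D.
  by rewrite (covector_at_ext_d iq) (paramK cx).
transitivity (mv_rep i L x [:: D; dcov l]); last first.
  rewrite [D]col_dcov (lin_fun_sum _ _ lin1); apply: eq_bigr => m _.
  by rewrite mxE.
rewrite /mv_rep -/q /= -covE.
have lin2 : lin_fun (fun xi => (L : mv_field M) q [:: covector_at (ext_d (form_of_fun a)) q; xi]).
  by move=> c u v; have := mL q [:: covector_at (ext_d (form_of_fun a)) q] [::] c u v.
rewrite [jac _ _ _ *m dcov l]col_dcov (lin_fun_sum _ _ lin2) mxE.
by apply: eq_bigr => m _; rewrite mulrC -[_ *m dcov l]colE !mxE.
Qed.

Fact conformal_vfP : is_vector_field (conformal_vf a L E).
Proof.
move=> i l; have oi := @cod_open _ _ M i; have [_ _ _ sL] := bivectorP L.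
apply: (smooth_ext oi (fun x cx => esym (vf_rep_conformal l cx))).
apply: smooth_lin => //.
  apply: smooth_sum => // m; apply: smooth_mul => //.
  by apply: smooth_derive; exact: smooth_functionP.
apply: smooth_mul => //; first exact: smooth_functionP.
exact: vector_fieldP.
Qed.

Definition conformal_bivector : bivector M := Bivector conformal_bvP.
Definition conformal_vector : vector_field M := VectorField conformal_vfP.

End ConformalChange.

(* Main.v *)
Require Import Defs.
From HB Require Import structures.
From mathcomp Require Import all_boot all_order all_algebra.
From mathcomp Require Import boolp classical_sets reals topology normedtype derive.
From mathcomp Require Import functions zify ring lra.

(* The map
     Phi_k (alpha, beta) =
       (a^-k alpha + (-1)^k a^(-k-1) da /\ beta, a^-k beta)
   is bijective on pairs and intertwines the two deltas.  Let D be the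
   codifferential i(L) d - d i(L).  Passing from L to a L replaces D by
   a D - da /\ i(L), and D (f alpha) = f D alpha + i_(#df) alpha; the power a^-k
   is the one for which the second correction cancels against the term
   k i_(#da) of k i_(E_a), and the summand da /\ beta absorbs the first one.
   The remaining terms match by D (da /\ beta) = - da /\ D beta - Lie_(#da) beta,
   L(da, da) = 0 and Leibniz rules.  The only second-order fact behind these
   identities is d (da /\ beta) = - da /\ d beta, i.e. the symmetry of the second
   derivatives of a. *)

Set Implicit Arguments.
Unset Strict Implicit.
Unset Printing Implicit Defensive.
Import Order.TTheory GRing.Theory Num.Theory.
Import numFieldNormedType.Exports.
Local Open Scope classical_set_scope.
Local Open Scope ring_scope.

(** * Symmetry of second derivatives *)

Section Schwarz.
Context {R : realType} {V : normedModType R}.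
Implicit Types (f : V -> R) (x y v w : V) (U : set V).

Lemma is_derive_line f y v (t : R) : differentiable f (y + t *: v) ->
  is_derive t 1 (fun s : R => f (y + s *: v)) ('D_v f (y + t *: v)).
Proof.
move=> df.
have dl : is_diff t (fun s : R => y + s *: v) (fun s : R => s *: v).
  by have := is_diffD (is_diff_cst y t) (is_diff_scalel t v); rewrite add0r.
have dc : differentiable (f \o (fun s : R => y + s *: v)) t.
  by apply: differentiable_comp => //; case: dl.
apply: DeriveDef; first exact: diff_derivable.
rewrite -[LHS]/('D_1 (f \o (fun s : R => y + s *: v)) t) deriveE //.
rewrite diff_comp; [|by case: dl|exact: df].
have -> : 'd (fun s : R => y + s *: v) t = (fun s : R => s *: v) :> (R -> V).
  by case: dl.
by rewrite /= scale1r -deriveE.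
Qed.

Lemma MVT_line f y v (h : R) : 0 < h ->
  (forall t, 0 <= t <= h -> differentiable f (y + t *: v)) ->
  exists2 c, 0 < c < h & f (y + h *: v) - f y = 'D_v f (y + c *: v) * h.
Proof.
move=> h0 df.
have df' t : 0 <= t <= h ->
    is_derive t 1 (fun s : R => f (y + s *: v)) ('D_v f (y + t *: v)).
  by move=> th; apply: is_derive_line; exact: df.
have [|c|c cI] := @MVT R (fun s : R => f (y + s *: v))
    (fun t => 'D_v f (y + t *: v)) 0 h h0.
- by move=> t; rewrite in_itv /= => /andP[t0 th]; apply: df'; rewrite !ltW.
- apply: derivable_within_continuous => t; rewrite in_itv /= => tI.
  by have [] := df' t tI.
rewrite subr0 scale0r addr0 => cE; exists c => //.
Qed.

(** The mean value theorem is applied twice: along v to the increment of f by h w, which yields s,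
    then along w to the derivative of f in the direction v, which yields t. The hypothesis on U
    keeps the whole parallelogram inside the domain of smoothness. *)
Lemma second_difference f U x v w (h : R) : 0 < h -> smooth_on U f ->
  (forall s t, 0 <= s <= h -> 0 <= t <= h -> U (x + s *: v + t *: w)) ->
  exists s t, [/\ 0 <= s <= h, 0 <= t <= h &
    f (x + h *: v + h *: w) - f (x + h *: v) - (f (x + h *: w) - f x) =
    'D_w ('D_v f) (x + s *: v + t *: w) * h ^+ 2].
Proof.
move=> h0 sf UI; have hh : 0 <= h <= h by apply/andP; split; rewrite ?lexx ?ltW.
have h00 : 0 <= (0 : R) <= h by apply/andP; split; rewrite ?lexx ?ltW.
pose g := (f \o shift (h *: w)) - f.
have df s t : 0 <= s <= h -> 0 <= t <= h -> differentiable f (x + s *: v + t *: w).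
  by move=> sI tI; apply: smooth_differentiable sf _; exact: UI.
have df0 s : 0 <= s <= h -> differentiable f (x + s *: v).
  by move=> sI; have := df s 0 sI h00; rewrite scale0r addr0.
have ds s : is_diff (x + s *: v) (shift (h *: w)) (id : V -> V).
  have := is_diffD (is_diff_id (x + s *: v)) (is_diff_cst (h *: w) (x + s *: v)).
  by rewrite addr0.
have dfs s : 0 <= s <= h -> differentiable (f \o shift (h *: w)) (x + s *: v).
  move=> sI; apply: differentiable_comp; last exact: df.
  by case: (ds s).
have [|s sI sE] := @MVT_line g x v h h0.
  by move=> t tI; apply: differentiableB; [exact: dfs|exact: df0].
have sI' : 0 <= s <= h by case/andP: sI => ? ?; rewrite !ltW.
have [|t tI tE] := @MVT_line ('D_v f) (x + s *: v) w h h0.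
  by move=> t tI; apply: smooth_differentiable (smooth_derive v sf) _; exact: UI.
exists s, t; split => //; first by case/andP: tI => ? ?; rewrite !ltW.
rewrite expr2 mulrA -tE.
have -> : 'D_v f (x + s *: v + h *: w) - 'D_v f (x + s *: v) = 'D_v g (x + s *: v).
  rewrite /g deriveB; [|exact/diff_derivable/dfs|exact/diff_derivable/df0].
  congr (_ - _); rewrite deriveE; last exact: df.
  rewrite deriveE; last exact: dfs.
  have dc := @is_diff_comp _ _ _ _ _ _ _ _ _ (ds s) (differentiableP (df s h sI' hh)).
  by rewrite (@diff_val _ _ _ _ _ _ _ dc).
by rewrite -sE /g !fctE /=.
Qed.

(** The second difference of f is symmetric in v and w, so after division by h^2 it is a value of
    each mixed derivative at some point of a small parallelogram at x. Continuity of both mixed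
    derivatives at x then brings their values at x within any e of each other. *)
Lemma derive_comm f U x v w : open U -> U x -> smooth_on U f ->
  'D_v ('D_w f) x = 'D_w ('D_v f) x.
Proof.
move=> oU Ux sf; apply/eqP; rewrite -subr_eq0 -normr_eq0; apply/eqP/le_anti.
rewrite normr_ge0 andbT; apply/ler_addgt0Pl => e e0; rewrite addr0.
have close (b c d : R) : `|b - d| < e / 2 -> `|c - d| < e / 2 -> `|b - c| <= e.
  move=> bd cd; rewrite -[b - c](subrKA d) -[d - c]opprB (splitr e).
  by apply: le_trans (ler_normB _ _) _; apply: lerD; exact: ltW.
have cont u u' : {for x, continuous ('D_u ('D_u' f))}.
  apply: differentiable_continuous.
  exact: smooth_differentiable (smooth_derive u (smooth_derive u' sf)) Ux.
have e20 : 0 < e / 2 by rewrite divr_gt0.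
have near1 u u' : \forall y \near x, `|'D_u ('D_u' f) x - 'D_u ('D_u' f) y| < e / 2.
  by have /cvgrPdist_lt/(_ _ e20) := cont u u'.
have nU : nbhs x U by exact: open_nbhs_nbhs.
have [d /= d0 dP] := (nbhs_normP x _).1 (filterI nU (filterI (near1 v w) (near1 w v))).
(* The summand 1 keeps N positive when v and w both vanish. With h N = d / 2 the parallelogram with
   sides h v and h w stays in the ball of radius d. *)
pose N := `|v| + `|w| + 1; have N0 : 0 < N by rewrite ltr_wpDl // addr_ge0.
pose h := d / (N * 2); have h0 : 0 < h by rewrite divr_gt0 // mulr_gt0.
have inb s t : 0 <= s <= h -> 0 <= t <= h -> ball_ Num.norm x d (x + s *: v + t *: w).
  move=> /andP[s0 sh] /andP[t0 th]; rewrite /ball_ /= -addrA opprD addNKr normrN.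
  apply: (le_lt_trans (ler_normD _ _)); rewrite !normrZ !ger0_norm //.
  apply: (@le_lt_trans _ _ (h * N)).
    rewrite /N 2!mulrDr mulr1; apply: (@le_trans _ _ (h * `|v| + h * `|w|)).
      by apply: lerD; apply: ler_wpM2r.
    by rewrite lerDl ltW.
  by have -> : h * N = d / 2; [rewrite /h; field; rewrite lt0r_neq0|lra].
have [s [t [sI tI st]]] := second_difference h0 sf
  (fun s t sI tI => (dP _ (inb s t sI tI)).1).
have inb' s' t' : 0 <= s' <= h -> 0 <= t' <= h ->
    ball_ Num.norm x d (x + s' *: w + t' *: v).
  by move=> s'I t'I; rewrite addrAC; exact: inb.
have [s' [t' [s'I t'I st']]] := second_difference h0 sf
  (fun s t sI tI => (dP _ (inb' s t sI tI)).1).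
have E : 'D_w ('D_v f) (x + s *: v + t *: w) = 'D_v ('D_w f) (x + s' *: w + t' *: v).
  apply: (@mulIf _ (h ^+ 2)); first by rewrite expf_neq0 // lt0r_neq0.
  apply: etrans (esym st) _; apply: etrans _ st'.
  by rewrite (addrAC x (h *: w)) !opprB !addrA; ring.
have [_ [_ b1]] := dP _ (inb s t sI tI).
have [_ [b2 _]] := dP _ (inb' s' t' s'I t'I).
by rewrite E in b1; exact: close b2 b1.
Qed.

End Schwarz.

(** * Alternating sums over a list with one entry removed *)

Section AlternatingSums.
Context {R : realType} {T : lmodType R}.
Implicit Types (F G : T -> seq T -> R) (s t : seq T) (u v w : T).

(* The shape shared by ext_d and by the wedge product with a 1-form. *)
Definition altsum F s : R :=
  \sum_(j < size s) (-1) ^+ j * F (nth 0 s j) (omit_nth j s).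

Lemma altsum_nil F : altsum F [::] = 0.
Proof. by rewrite /altsum big_ord0. Qed.

(** This recursion replaces index bookkeeping: removing a later entry costs one extra sign, and most
    facts about [altsum] follow from it by induction on the list. *)
Lemma altsum_cons F v s :
  altsum F (v :: s) = F v s - altsum (fun w t => F w (v :: t)) s.
Proof.
rewrite /altsum big_ord_recl /= expr0 mul1r /omit_nth /= drop0 -sumrN.
congr (_ + _); apply: eq_bigr => j _.
by rewrite /bump /= add1n exprS mulN1r mulNr.
Qed.

Lemma eq_altsum F G s : (forall w t, F w t = G w t) -> altsum F s = altsum G s.
Proof. by move=> FG; apply: eq_bigr => j _; rewrite FG. Qed.

Lemma altsumP c F G s :
  altsum (fun w t => c * F w t + G w t) s = c * altsum F s + altsum G s.
Proof.
rewrite /altsum mulr_sumr -big_split; apply: eq_bigr => j _ /=.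
by rewrite mulrDr mulrCA.
Qed.

Lemma altsumD F G s :
  altsum (fun w t => F w t + G w t) s = altsum F s + altsum G s.
Proof.
by rewrite -[altsum F s]mul1r -altsumP; apply: eq_altsum => w t; rewrite mul1r.
Qed.

Lemma altsum0 s : altsum (fun=> fun=> 0) s = 0.
Proof. by rewrite /altsum big1 // => j _; rewrite mulr0. Qed.

Lemma altsumZ c F s : altsum (fun w t => c * F w t) s = c * altsum F s.
Proof.
rewrite -[RHS]addr0 -(altsum0 s) -altsumP.
by apply: eq_altsum => w t; rewrite addr0.
Qed.

Lemma altsumN F s : altsum (fun w t => - F w t) s = - altsum F s.
Proof. by rewrite -mulN1r -altsumZ; apply: eq_altsum => w t; rewrite mulN1r. Qed.

Lemma altsumB F G s :
  altsum (fun w t => F w t - G w t) s = altsum F s - altsum G s.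
Proof. by rewrite altsumD altsumN. Qed.

Lemma altsum_map (h : T -> T) F s :
  altsum F (map h s) = altsum (fun w t => F (h w) (map h t)) s.
Proof.
elim: s F => [|v s IH] F; first by rewrite !altsum_nil.
by rewrite /= !altsum_cons IH.
Qed.

(* The common source of d (d f) = 0 and of th /\ th = 0 for a 1-form th. *)
Lemma altsum_anticomm (G : T -> T -> seq T -> R) s :
  altsum (fun v => altsum (G v)) s = - altsum (fun w => altsum (G ^~ w)) s.
Proof.
elim: s G => [|x s IH] G; first by rewrite !altsum_nil oppr0.
(* Peeling x off both sums leaves two single sums, which trade places and hence signs when H is
   transposed, and a double sum over s that falls to the induction hypothesis. *)
have expand (H : T -> T -> seq T -> R) : altsum (fun v => altsum (H v)) (x :: s) =
    altsum (H x) s - altsum (H ^~ x) s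
    + altsum (fun v => altsum (fun w t => H v w (x :: t))) s.
  rewrite altsum_cons -addrA; congr (_ + _).
  rewrite [RHS]addrC -[RHS]opprB -altsumB; congr (- _).
  by apply: eq_altsum => w t; rewrite altsum_cons.
rewrite expand (expand (fun v w => G w v)) IH; ring.
Qed.

Lemma altsum_degree (k : int) F s : (forall w, of_degree k (F w)) ->
  (size s)%:Z != k + 1 -> altsum F s = 0.
Proof.
move=> dF sk; rewrite /altsum big1 // => j _; rewrite dF ?mulr0 //.
apply: contraNneq sk => <-; rewrite /omit_nth size_cat size_drop size_takel.
  by rewrite -PoszD; apply/eqP; congr Posz; rewrite addn1 -addSn subnKC.
exact: ltnW.
Qed.

Lemma altsum_multilinear F : (forall t, lin_fun (F ^~ t)) ->
  (forall w, multilinear (F w)) -> multilinear (altsum F).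
Proof.
move=> lF mF s1 s2 c u v; elim: s1 F lF mF => [|x s1 IH] F lF mF.
  rewrite /= !altsum_cons lF.
  have -> : altsum (fun w t => F w (c *: u + v :: t)) s2 =
      c * altsum (fun w t => F w (u :: t)) s2 + altsum (fun w t => F w (v :: t)) s2.
    by rewrite -altsumP; apply: eq_altsum => w t; exact: (mF w [::] t).
  ring.
rewrite /= !altsum_cons mF IH; first by ring.
  by move=> t; exact: lF.
by move=> w s3 s4; exact: (mF w (x :: s3) s4).
Qed.

(** Polarization: the value with u + v in both adjacent slots vanishes, and so do its two diagonal
    terms, so the mixed terms are opposite. *)
Lemma alternating_swap (al : seq T -> R) s1 s2 u v :
  multilinear al -> alternating al ->
  al (s1 ++ u :: v :: s2) = - al (s1 ++ v :: u :: s2).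
Proof.
move=> ml aal; apply/eqP; rewrite -subr_eq0 opprK; apply/eqP.
have aD t1 t2 w w' : al (t1 ++ (w + w') :: t2) =
    al (t1 ++ w :: t2) + al (t1 ++ w' :: t2).
  by rewrite -[w in LHS]scale1r ml mul1r.
have aD' w w' : al (s1 ++ w :: (u + v) :: s2) =
    al (s1 ++ w :: u :: s2) + al (s1 ++ w :: v :: s2).
  by have := aD (rcons s1 w) s2 u v; rewrite !cat_rcons.
have := aal s1 [::] s2 (u + v); rewrite /= aD !aD' //.
have := aal s1 [::] s2 u; rewrite /= => ->; have := aal s1 [::] s2 v; rewrite /= => ->.
by rewrite add0r addr0.
Qed.

Lemma alternating_move (al : seq T -> R) s1 s2 u :
  multilinear al -> alternating al ->
  al (s1 ++ u :: s2) = (-1) ^+ size s1 * al (u :: s1 ++ s2).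
Proof.
elim: s1 al => [|x s1 IH] al ml aal; first by rewrite expr0 mul1r.
rewrite /= (IH (fun s => al (x :: s))).
- by rewrite (alternating_swap [::]) //= exprS; ring.
- by move=> s3 s4; exact: (ml (x :: s3) s4).
- by move=> s3 s4; exact: (aal (x :: s3) s4).
Qed.

Lemma altsum_alternating F : (forall w, multilinear (F w)) ->
  (forall w, alternating (F w)) -> alternating (altsum F).
Proof.
move=> mF aF s1 s2 s3 u; elim: s1 F mF aF => [|x s1 IH] F mF aF; last first.
  rewrite /= altsum_cons aF IH ?subr0 // => w s4.
    by move=> s5; exact: (mF w (x :: s4) s5).
  by move=> s5 s6 y; exact: (aF w (x :: s4) s5).
(* Every summand that keeps an entry u next to a function vanishing on lists containing u is zero,
   so only the summand removing that u survives. With another u in front, this survivor cancels the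
   head summand once [alternating_move] brings u to the front. *)
have single G : (forall w t1 t2, G w (t1 ++ u :: t2) = 0) ->
    altsum G (s2 ++ u :: s3) = (-1) ^+ size s2 * G u (s2 ++ s3).
  elim: s2 G => [|x s2 IH] G G0 /=; rewrite altsum_cons.
    rewrite expr0 mul1r -[RHS]subr0; congr (_ - _); rewrite -[RHS](altsum0 s3).
    by apply: eq_altsum => w t; exact: (G0 w [::]).
  rewrite G0 IH ?exprS; first by ring.
  by move=> w t1 t2; exact: (G0 w (x :: t1)).
rewrite /= altsum_cons single; last first.
  by move=> w t1 t2; exact: (aF w [::] t1).
by rewrite (alternating_move _ _ _ (mF u) (aF u)) subrr.
Qed.

End AlternatingSums.

(** * Derivatives of alternating sums *)

Section AlternatingSumDerivatives.
Context {R : realType} {V : normedModType R}.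

Lemma is_derive_altsum (T : lmodType R) (F : T -> seq T -> V -> R) dF s x v :
  (forall w t, is_derive x v (F w t) (dF w t)) ->
  is_derive x v (fun y => altsum (fun w t => F w t y) s) (altsum dF s).
Proof.
elim: s F dF => [|u s IH] F dF dFP.
  rewrite altsum_nil.
  have -> : (fun y => altsum (fun w t => F w t y) [::]) = cst 0.
    by apply/funext => y; rewrite altsum_nil.
  exact: is_derive_cst.
rewrite altsum_cons.
have -> : (fun y => altsum (fun w t => F w t y) (u :: s)) =
    F u s - (fun y => altsum (fun w t => F w (u :: t) y) s).
  by apply/funext => y; rewrite altsum_cons.
apply: is_deriveB.
exact: (IH (fun w t => F w (u :: t)) (fun w t => dF w (u :: t))).
Qed.

Lemma smooth_altsum (T : lmodType R) (U : set V) (F : T -> seq T -> V -> R) s :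
  open U -> (forall w t, smooth_on U (F w t)) ->
  smooth_on U (fun y => altsum (fun w t => F w t y) s).
Proof.
move=> oU sF; apply: smooth_sum => // j; apply: smooth_mul => //.
exact: smooth_cst.
Qed.

(** Coordinate form of d (th /\ be) = - th /\ d be for a closed 1-form th with coefficients A; the
    symmetry hypothesis on A is closedness. The Leibniz rule splits the left side in two: the part
    with derivatives of A vanishes, and in the other part exchanging the two sums produces the
    sign. *)
Lemma altsum_derive_wedge (A : V -> V -> R) (B : seq V -> V -> R) s x :
  (forall w, differentiable (A w) x) -> (forall t, differentiable (B t) x) ->
  (forall v w, 'D_v (A w) x = 'D_w (A v) x) ->
  altsum (fun v t => 'D_v (fun y => altsum (fun w r => A w y * B r y) t) x) s =
  - altsum (fun w t => A w x * altsum (fun v r => 'D_v (B r) x) t) s.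
Proof.
move=> dA dB sA.
have dAB v w r : is_derive x v (fun y => A w y * B r y)
    (A w x * 'D_v (B r) x + 'D_v (A w) x * B r x).
  rewrite ['D_v (A w) x * _]mulrC.
  by apply: is_deriveM; apply: derivableP; apply: diff_derivable.
transitivity (altsum (fun v => altsum (fun w r =>
    A w x * 'D_v (B r) x + 'D_v (A w) x * B r x)) s).
  by apply: eq_altsum => v t; have D := is_derive_altsum t (dAB v); exact: derive_val.
(* The summand is symmetric in v and w by [sA], while exchanging the two sums changes the sign. *)
have antisym0 : altsum (fun v => altsum (fun w r => 'D_v (A w) x * B r x)) s = 0.
  set S := altsum _ s; suff : S = - S by lra.
  rewrite {1}/S altsum_anticomm; congr (- _).
  by apply: eq_altsum => v t; apply: eq_altsum => w r; rewrite sA.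
rewrite -[RHS]addr0 -antisym0.
have -> : altsum (fun w t => A w x * altsum (fun v r => 'D_v (B r) x) t) s =
    altsum (fun w => altsum (fun v r => A w x * 'D_v (B r) x)) s.
  by apply: eq_altsum => w t; rewrite altsumZ.
rewrite -(altsum_anticomm (fun v w r => A w x * 'D_v (B r) x)) -altsumD.
by apply: eq_altsum => v t; rewrite altsumD.
Qed.

End AlternatingSumDerivatives.

(** * Integer powers of nonvanishing smooth functions *)

Section SmoothPowers.
Context {R : realType} {V : normedModType R}.
Implicit Types (f : V -> R) (x v : V) (U : set V).

(** The derivative - f^-2 D_v f is a product of two copies of f^-1 and a smooth function, so the
    induction on the order of differentiability closes. *)
Lemma smooth_inv U f : open U -> (forall x, U x -> f x != 0) ->
  smooth_on U f -> smooth_on U (fun x => (f x)^-1).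
Proof.
move=> oU f0 sf k.
have : forall x, U x -> differentiable (fun y => (f y)^-1) x.
  by move=> x Ux; apply: differentiableV (f0 x Ux); exact: smooth_differentiable sf Ux.
move=> dfV; elim: k => [x Ux|k IH]; first exact/differentiable_continuous/dfV.
split=> // v.
apply: (@Ck_ext _ _ _ _ _ (fun x => - 1 * ((f x)^-1 * (f x)^-1) * 'D_v f x)) => //.
  move=> x Ux; rewrite deriveV ?f0 //; last
    exact/diff_derivable/(smooth_differentiable sf Ux).
  by rewrite -[LHS]/(_ *: _); congr (_ *: _); rewrite mulN1r -expr2 exprVn.
apply: CkM => //; last exact: smooth_derive.
by apply: CkM => //; [exact: Ck_cst|exact: CkM].
Qed.

Lemma smooth_exprz U f (m : int) : open U -> (forall x, U x -> f x != 0) ->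
  smooth_on U f -> smooth_on U (fun x => f x ^ m).
Proof.
move=> oU f0 sf.
have sX i : smooth_on U (fun x => f x ^+ i).
  elim: i => [|i IH]; first exact: smooth_cst.
  apply: (@smooth_ext _ _ _ _ (fun x => f x * f x ^+ i)) => // [x _|].
    by rewrite exprS.
  exact: smooth_mul.
case: m => i; first exact: sX.
apply: (@smooth_inv U (fun x => f x ^+ i.+1)) => // x Ux.
by rewrite expf_neq0 // f0.
Qed.

Lemma derive_exprz f (m : int) x v : f x != 0 -> derivable f x v ->
  'D_v (fun y => f y ^ m) x = m%:~R * f x ^ (m - 1) * 'D_v f x.
Proof.
move=> f0 df.
have fX i : f ^+ i = (fun y => f y ^+ i).
  by elim: i => [|i IH]; apply/funext => y; rewrite ?expr0 // !exprS IH.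
case: m => [i|i].
  have -> : (fun y => f y ^ Posz i) = f ^+ i by rewrite fX.
  rewrite deriveX // -[LHS]/(_ * _); congr (_ * _).
  (* For exponent 0 the natural predecessor is 0 and the integer one is -1, but both sides carry the
     factor 0. *)
  case: i => [|i]; first by rewrite !mul0r.
  by rewrite /= (_ : Posz i.+1 - 1 = i) //; lia.
have -> : (fun y => f y ^ Negz i) = (fun y => ((f ^+ i.+1) y)^-1) by rewrite fX.
have dX := @derivableX _ _ f i.+1 x v df.
have fi0 : (f ^+ i.+1) x != 0 by rewrite fX expf_neq0.
rewrite (deriveV fi0); last exact: dX.
rewrite (deriveX i.+1 df) -[LHS]/(_ * (_ * _)) mulrA; congr (_ * _).
have -> : Negz i - 1 = Negz i.+1 by lia.
rewrite NegzE mulrNz -[_ ^ _]/((f x ^+ i.+2)^-1) fX /=.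
rewrite !exprS; field.
by rewrite f0 expf_neq0.
Qed.

End SmoothPowers.

(** * Exterior calculus on the manifold *)

Section ExteriorCalculus.
Context {R : realType} {n : nat} {M : manifold R n}.
Implicit Types (f : M -> R) (th al be : form_field M) (L : mv_field M).
Implicit Types (X : M -> 'rV[R]_n).

Definition fscale f al : form_field M := fun p s => f p * al p s.

Definition wedge1 th al : form_field M :=
  fun p => altsum (fun w t => th p [:: w] * al p t).

Lemma ext_dE al p s : ext_d al p s =
  altsum (fun w t => 'D_w (form_rep (base p) al ^~ t) (at_base p)) s.
Proof. by []. Qed.

Lemma form_rep_wedge1 i th al x s : form_rep i (wedge1 th al) x s =
  altsum (fun w t => form_rep i th x [:: w] * form_rep i al x t) s.
Proof. exact: altsum_map. Qed.

Lemma rep_smooth_fscale f al :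
  is_smooth_function f -> rep_smooth al -> rep_smooth (fscale f al).
Proof.
by move=> sf sal i s; apply: smooth_mul; [exact: open_cod|exact: sf|exact: sal].
Qed.

Lemma rep_smooth_wedge1 th al :
  rep_smooth th -> rep_smooth al -> rep_smooth (wedge1 th al).
Proof.
move=> sth sal i s; have oi := @cod_open _ _ M i.
apply: (smooth_ext oi (fun x _ => esym (form_rep_wedge1 i th al x s))).
by apply: smooth_altsum => // w t; exact: smooth_mul.
Qed.

Lemma rep_smooth_lin c al be :
  rep_smooth al -> rep_smooth be -> rep_smooth (c *: al + be).
Proof. by move=> sal sbe i s; apply: smooth_lin (sal i s) (sbe i s); exact: cod_open. Qed.

Lemma rep_smoothD al be : rep_smooth al -> rep_smooth be -> rep_smooth (al + be).
Proof. by move=> sal sbe; rewrite -[al]scale1r; exact: rep_smooth_lin. Qed.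

Lemma rep_smooth0 : rep_smooth (0 : form_field M).
Proof. by have [] := @is_form0 _ _ M 0. Qed.

Lemma rep_smoothZ c al : rep_smooth al -> rep_smooth (c *: al).
Proof.
move=> sal; rewrite -[_ *: _]addr0; apply: rep_smooth_lin => //.
exact: rep_smooth0.
Qed.

Lemma rep_differentiable al p s : rep_smooth al ->
  differentiable (form_rep (base p) al ^~ s) (at_base p).
Proof.
by move=> sal; apply: smooth_differentiable (sal _ _) (cod_coord (base_dom p)).
Qed.

Lemma ext_d_multilinear al : (forall p, multilinear (al p)) -> rep_smooth al ->
  forall p, multilinear (ext_d al p).
Proof.
move=> ml sal p; apply: (@altsum_multilinear _ _
    (fun w t => 'D_w (form_rep (base p) al ^~ t) (at_base p))).
  move=> t c u v; have da := @rep_differentiable al p t sal.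
  by rewrite !deriveE // linearP.
move=> w s1 s2 c u v.
have da t : derivable (form_rep (base p) al ^~ t) (at_base p) w.
  exact/diff_derivable/rep_differentiable.
have -> : form_rep (base p) al ^~ (s1 ++ (c *: u + v) :: s2) =
    c \*: (form_rep (base p) al ^~ (s1 ++ u :: s2))
    + (form_rep (base p) al ^~ (s1 ++ v :: s2)).
  by apply/funext => x; rewrite (form_rep_multilinear _ _ ml).
by rewrite deriveD ?deriveZ //; exact: derivableZ.
Qed.

Lemma is_form_fun f : is_smooth_function f -> is_form 0 (form_of_fun f).
Proof.
move=> sf; split=> [p [|v s]|p [|w s1] s2 c u v|p [|w s1] s2 s3 u|i [|v s]] //=;
  try by [rewrite mulr0 addr0 | exact: sf | exact: smooth_cst].
Qed.

(** [ext_d] is computed in the preferred chart of each point, which varies with the point. The chain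
    rule for the transition map brings the derivative to the fixed chart i, where smoothness can be
    read off. *)
Lemma form_rep_d_fun f i x v : is_smooth_function f -> cod i x ->
  form_rep i (ext_d (form_of_fun f)) x [:: v] = 'D_v (f \o chart_param (atlas i)) x.
Proof.
move=> sf cx; have iq := param_dom cx.
have bq := base_dom (chart_param (atlas i) x).
rewrite /form_rep /= /ext_d big_ord1 expr0 mul1r /=.
rewrite -[X in _ = 'D_v _ X](paramK cx) (derive_change_chart _ iq bq) //.
exact: smooth_differentiable (sf _) (cod_coord bq).
Qed.

Lemma is_form_d_fun f : is_smooth_function f -> is_form 1 (ext_d (form_of_fun f)).
Proof.
move=> sf; have [df mf _ ssf] := is_form_fun sf.
have deg p : of_degree 1 (ext_d (form_of_fun f) p).
  move=> s s1; apply: (@altsum_degree _ _ 0 (fun w t =>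
    'D_w (form_rep (base p) (form_of_fun f) ^~ t) (at_base p))) => //.
  move=> w t t0; have -> : form_rep (base p) (form_of_fun f) ^~ t = cst 0.
    by apply/funext => x; apply: df; rewrite size_map.
  exact: derive_cst.
split=> //; first exact: ext_d_multilinear.
  move=> p s1 s2 s3 u; apply: deg; rewrite size_cat /= size_cat /=; lia.
move=> i s; have oi := @cod_open _ _ M i.
have [/eqP s1|s1] := boolP ((size s)%:Z == 1); last first.
  apply: (smooth_ext oi) (smooth_cst _ 0) => x _.
  by rewrite /form_rep deg // size_map.
case: s s1 => [|v [|]] // _.
apply: (smooth_ext oi (fun x cx => esym (form_rep_d_fun v sf cx))).
exact: smooth_derive.
Qed.

Lemma is_form_fscale k f al :
  is_smooth_function f -> is_form k al -> is_form k (fscale f al).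
Proof.
move=> sf [dal mal aal sal]; rewrite /fscale; split.
- by move=> p s sz; rewrite dal ?mulr0.
- by move=> p s1 s2 c u v; rewrite mal mulrDr mulrCA.
- by move=> p s1 s2 s3 u; rewrite aal mulr0.
- exact: rep_smooth_fscale.
Qed.

Lemma is_form_wedge1 k th al :
  is_form 1 th -> is_form k al -> is_form (k + 1) (wedge1 th al).
Proof.
move=> [dth mth ath sth] [dal mal aal sal]; split.
- move=> p s sz; apply: (@altsum_degree _ _ k) => // w t tz.
  by rewrite dal ?mulr0.
- move=> p; apply: altsum_multilinear => [t c u v|w s1 s2 c u v].
    by rewrite (mth p [::] [::]) mulrDl mulrA.
  by rewrite mal mulrDr mulrCA.
- move=> p; apply: altsum_alternating => [w s1 s2 c u v|w s1 s2 s3 u].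
    by rewrite mal mulrDr mulrCA.
  by rewrite aal mulr0.
- exact: rep_smooth_wedge1.
Qed.

Lemma wedge1_lin th c al be :
  wedge1 th (c *: al + be) = c *: wedge1 th al + wedge1 th be.
Proof.
apply/funext => p; apply/funext => s; rewrite -[RHS]altsumP.
by apply: eq_altsum => w t; rewrite !fctE mulrDr; congr (_ + _); exact: mulrCA.
Qed.

Lemma wedge1_fscale th f al : wedge1 th (fscale f al) = fscale f (wedge1 th al).
Proof.
apply/funext => p; apply/funext => s; rewrite -[RHS]altsumZ.
by apply: eq_altsum => w t; exact: mulrCA.
Qed.

Lemma contr_bv_fscale L f al : contr_bv L (fscale f al) = fscale f (contr_bv L al).
Proof.
apply/funext => p; apply/funext => s; rewrite /contr_bv /fscale mulrCA.
congr (_ * _); rewrite mulr_sumr; apply: eq_bigr => a _; rewrite mulr_sumr.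
by apply: eq_bigr => b _; exact: mulrCA.
Qed.

Lemma contr_conformal_bv f L al :
  contr_bv (conformal_bv f L) al = fscale f (contr_bv L al).
Proof.
rewrite -contr_bv_fscale; apply/funext => p; apply/funext => s.
congr (_ * _); apply: eq_bigr => a _; apply: eq_bigr => b _.
by rewrite /conformal_bv /fscale mulrCA mulrA.
Qed.

(** The antiderivation rule is [altsum_cons] with [X p] at the head of the list. *)
Lemma contr_vf_wedge1 X th al : contr_vf X (wedge1 th al) =
  fscale (fun p => th p [:: X p]) al - wedge1 th (contr_vf X al).
Proof. by apply/funext => p; apply/funext => s; exact: altsum_cons. Qed.

(** On a list starting with basis vectors e_a, e_b, the wedge expands into th(e_a) al(e_b, ..) -
    th(e_b) al(e_a, ..) plus the summands where th takes a later entry. Contracted with L, the later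
    summands give th /\ i(L) al and the first two give the contraction with the sharp of th. *)
Lemma contr_bv_wedge1 L th al : (forall p, multilinear (L p)) ->
  (forall p, alternating (L p)) -> (forall p, multilinear (al p)) ->
  contr_bv L (wedge1 th al) =
  wedge1 th (contr_bv L al) + contr_vf (sharp L th) al.
Proof.
move=> mL aL mal; apply/funext => p; apply/funext => s.
pose Lc a b := L p [:: dcov a; dcov b].
have LcN a b : Lc a b = - Lc b a by exact: (alternating_swap [::] [::] _ _ (mL p) (aL p)).
pose t a := th p [:: dvec a]; pose A b := al p (dvec b :: s).
have altE : wedge1 th (contr_bv L al) p s = 2^-1 * \sum_(a < n) \sum_(b < n)
    Lc a b * altsum (fun w r => th p [:: w] * al p [:: dvec a, dvec b & r]) s.
  rewrite /wedge1 /altsum mulr_sumr.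
  transitivity (\sum_(a < n) 2^-1 * \sum_(b < n) \sum_(j < size s) Lc a b *
    ((-1) ^+ j * (th p [:: nth 0 s j] * al p [:: dvec a, dvec b & omit_nth j s]))).
    under [RHS]eq_bigr => a _ do rewrite exchange_big mulr_sumr /=.
    rewrite exchange_big /=; apply: eq_bigr => j _.
    rewrite /contr_bv -mulr_sumr !mulrA mulr_sumr.
    rewrite mulr_sumr; apply: eq_bigr => a _; rewrite !mulr_sumr.
    by apply: eq_bigr => b _; rewrite -/(Lc a b); ring.
  by apply: eq_bigr => a _; congr (_ * _); apply: eq_bigr => b _; rewrite mulr_sumr.
have sharpE : contr_vf (sharp L th) al p s =
    \sum_(a < n) \sum_(b < n) Lc a b * (t a * A b).
  rewrite /contr_vf [sharp L th p]row_dvec.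
  have lA : lin_fun (fun v => al p (v :: s)).
    by move=> c u v; exact: (mal p [::] s).
  rewrite (lin_fun_sum _ _ lA) exchange_big /=; apply: eq_bigr => b _.
  have lL : lin_fun (fun xi => L p [:: xi; dcov b]).
    by move=> c u v; exact: (mL p [::] [:: dcov b]).
  rewrite mxE [covector_at th p]col_dcov (lin_fun_sum _ _ lL) mulr_suml.
  by apply: eq_bigr => a _; rewrite mxE -/(Lc a b) -/(t a) -/(A b); ring.
rewrite -[RHS]/(wedge1 th (contr_bv L al) p s + contr_vf (sharp L th) al p s).
rewrite altE sharpE.
(* Antisymmetry of L makes the sum equal to half of its antisymmetrization, which matches the factor
   2^-1 in [contr_bv]. *)
have -> : \sum_(a < n) \sum_(b < n) Lc a b * (t a * A b) =
   2^-1 * \sum_(a < n) \sum_(b < n) (Lc a b * (t a * A b) - Lc a b * (t b * A a)).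
  under [in RHS]eq_bigr => a _ do rewrite big_split /=.
  rewrite big_split /= [X in _ + X]exchange_big /=.
  set S := (X in X = _).
  have -> : \sum_(j < n) \sum_(i < n) - (Lc i j * (t j * A i)) = S.
    by apply: eq_bigr => a _; apply: eq_bigr => b _; rewrite LcN; ring.
  by rewrite -/S; field.
rewrite -mulrDr -big_split /=; congr (_ * _); apply: eq_bigr => a _.
rewrite -big_split /=; apply: eq_bigr => b _.
rewrite -/(Lc a b) /wedge1 !altsum_cons -/(t a) -/(A b) -/(t b) -/(A a).
ring.
Qed.

Lemma ext_d_fscale f al : is_smooth_function f -> rep_smooth al ->
  ext_d (fscale f al) = wedge1 (ext_d (form_of_fun f)) al + fscale f (ext_d al).
Proof.
move=> sf sal; apply/funext => p; apply/funext => s.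
have cp : cod (base p) (at_base p) := cod_coord (base_dom p).
have -> : (wedge1 (ext_d (form_of_fun f)) al + fscale f (ext_d al)) p s =
    altsum (fun w t => ext_d (form_of_fun f) p [:: w] * al p t) s +
    f p * altsum (fun w t => 'D_w (form_rep (base p) al ^~ t) (at_base p)) s by [].
rewrite ext_dE -altsumZ -altsumD; apply: eq_altsum => w t.
have pK : chart_param (atlas (base p)) (at_base p) = p by apply: coordK; exact: base_dom.
have alE : form_rep (base p) al (at_base p) t = al p t.
  rewrite /form_rep pK jac_id; last exact: base_dom.
  by rewrite (eq_map (g := id)) ?map_id // => v; rewrite mulmx1.
have -> : form_rep (base p) (fscale f al) ^~ t =
   (f \o chart_param (atlas (base p))) * (form_rep (base p) al ^~ t) by [].
rewrite deriveM; first last.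
- exact/diff_derivable/rep_differentiable.
- exact/diff_derivable/(smooth_differentiable (sf _) cp).
rewrite alE /= pK [RHS]addrC -[LHS]/(_ * _ + _ * _); congr (_ + _).
rewrite mulrC; congr (_ * _).
by rewrite /ext_d big_ord1 expr0 mul1r.
Qed.

Lemma ext_d_wedge1 f al : is_smooth_function f -> rep_smooth al ->
  ext_d (wedge1 (ext_d (form_of_fun f)) al) =
  - wedge1 (ext_d (form_of_fun f)) (ext_d al).
Proof.
move=> sf sal; apply/funext => p; apply/funext => s.
have cp : cod (base p) (at_base p) := cod_coord (base_dom p).
pose A w := 'D_w (f \o chart_param (atlas (base p))).
pose B t := form_rep (base p) al ^~ t.
transitivity (altsum (fun v t =>
    'D_v (fun y => altsum (fun w r => A w y * B r y) t) (at_base p)) s).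
  (* A derivative sees a neighbourhood, so the coefficients of df are needed on the whole codomain
     of the chart of p, where the preferred chart of the varying point may differ from [base p]. *)
  rewrite ext_dE; apply: eq_altsum => v t; apply: near_eq_derive.
  apply: open_near (@cod_open _ _ M (base p)) cp _ => y cy.
  rewrite form_rep_wedge1; apply: eq_altsum => w r.
  by rewrite form_rep_d_fun.
rewrite altsum_derive_wedge.
- congr (- _); apply: eq_altsum => w t; congr (_ * _).
  by rewrite /ext_d big_ord1 expr0 mul1r.
- by move=> w; apply: smooth_differentiable (smooth_derive w (sf _)) cp.
- by move=> t; exact: rep_differentiable.
- by move=> v w; exact: derive_comm (@cod_open _ _ M (base p)) cp (sf _).
Qed.

End ExteriorCalculus.

(** * The codifferential of a bivector *)

Section Codifferential.
Context {R : realType} {n : nat} {M : manifold R n}.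
Implicit Types (f c : M -> R) (th al be : form_field M) (X : M -> 'rV[R]_n).

Lemma form_fieldD al be p s : (al + be) p s = al p s + be p s. Proof. by []. Qed.
Lemma form_fieldN al p s : (- al) p s = - al p s. Proof. by []. Qed.
Lemma form_fieldZ (z : R) al p s : (z *: al) p s = z * al p s. Proof. by []. Qed.
Lemma form_field0 p s : (0 : form_field M) p s = 0. Proof. by []. Qed.
Lemma fscaleE f al p s : fscale f al p s = f p * al p s. Proof. by []. Qed.
Definition form_fieldE := (form_fieldD, form_fieldN, form_fieldZ, form_field0, fscaleE).

Lemma wedge1D th al be : wedge1 th (al + be) = wedge1 th al + wedge1 th be.
Proof. by rewrite -[al in LHS]scale1r wedge1_lin scale1r. Qed.

Lemma wedge1Z th (z : R) al : wedge1 th (z *: al) = z *: wedge1 th al.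
Proof.
apply/funext => p; apply/funext => s; rewrite form_fieldZ -altsumZ.
by apply: eq_altsum => w t; rewrite form_fieldZ mulrCA.
Qed.

Lemma wedge1N th al : wedge1 th (- al) = - wedge1 th al.
Proof. by rewrite -scaleN1r wedge1Z scaleN1r. Qed.

Lemma wedge1_fscalel c th al : wedge1 (fscale c th) al = fscale c (wedge1 th al).
Proof.
apply/funext => p; apply/funext => s; rewrite fscaleE -altsumZ.
by apply: eq_altsum => w t; rewrite fscaleE mulrA.
Qed.

Lemma wedge1_wedge1 th al : wedge1 th (wedge1 th al) = 0.
Proof.
apply/funext => p; apply/funext => s; rewrite form_field0.
have -> : wedge1 th (wedge1 th al) p s =
    altsum (fun v => altsum (fun w t => th p [:: v] * (th p [:: w] * al p t))) s.
  by apply: eq_altsum => w t; rewrite altsumZ.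
(* The summand is symmetric in v and w, so exchanging the sums gives S = - S. *)
set S := altsum _ s; suff : S = - S by lra.
rewrite {1}/S altsum_anticomm; congr (- _).
by apply: eq_altsum => v t; apply: eq_altsum => w r; rewrite mulrCA.
Qed.

Lemma contr_vfD X al be : contr_vf X (al + be) = contr_vf X al + contr_vf X be.
Proof. by []. Qed.

Lemma contr_vfZ X (z : R) al : contr_vf X (z *: al) = z *: contr_vf X al.
Proof. by []. Qed.

Lemma contr_vf_fscale X f al : contr_vf X (fscale f al) = fscale f (contr_vf X al).
Proof. by []. Qed.

Lemma contr_bvD L al be : contr_bv L (al + be) = contr_bv L al + contr_bv L be.
Proof. by rewrite -[al in LHS]scale1r contr_bv_lin scale1r. Qed.

Lemma contr_bvZ L z al : contr_bv L (z *: al) = z *: contr_bv L al.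
Proof.
apply/funext => p; apply/funext => s; rewrite form_fieldZ /contr_bv mulrCA.
congr (_ * _); rewrite mulr_sumr; apply: eq_bigr => a _; rewrite mulr_sumr.
by apply: eq_bigr => b _; rewrite form_fieldZ mulrCA.
Qed.

Lemma contr_bvN L al : contr_bv L (- al) = - contr_bv L al.
Proof. by rewrite -scaleN1r contr_bvZ scaleN1r. Qed.

Lemma ext_dD al be : rep_smooth al -> rep_smooth be ->
  ext_d (al + be) = ext_d al + ext_d be.
Proof. by move=> sal sbe; rewrite -[al in LHS]scale1r ext_d_lin // scale1r. Qed.

Lemma ext_dZ (z : R) al : rep_smooth al -> ext_d (z *: al) = z *: ext_d al.
Proof.
move=> sal; have s0 := @rep_smooth0 R n M.
have d00 : ext_d (0 : form_field M) = 0.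
  have := ext_dD s0 s0; rewrite addr0 => d0.
  by apply: (@addrI _ (ext_d 0)); rewrite -d0 addr0.
by rewrite -[z *: al]addr0 ext_d_lin // d00 addr0.
Qed.

(** For a Poisson bivector this commutator is the Koszul-Brylinski boundary operator. *)
Definition codiff (L : mv_field M) al := contr_bv L (ext_d al) - ext_d (contr_bv L al).

Variable L : bivector M.

Lemma codiffD k al be : is_form k al -> is_form k be ->
  codiff L (al + be) = codiff L al + codiff L be.
Proof.
move=> fal fbe; have [_ _ _ sal] := fal; have [_ _ _ sbe] := fbe.
have sL := bivectorP L.
rewrite /codiff ext_dD // !contr_bvD ext_dD; first by rewrite opprD addrACA.
- exact: smooth_contr_bv sL fal.
- exact: smooth_contr_bv sL fbe.
Qed.

Lemma codiffZ k (z : R) al : is_form k al -> codiff L (z *: al) = z *: codiff L al.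
Proof.
move=> fal; have [_ _ _ sal] := fal; have sL := bivectorP L.
rewrite /codiff ext_dZ // !contr_bvZ ext_dZ ?scalerBr //.
exact: smooth_contr_bv sL fal.
Qed.

(** Both i(L) d and d i(L) produce the term df /\ i(L) al, which cancels; what remains of the
    Leibniz rule is the sharp term of [contr_bv_wedge1]. Writing df as c th lets powers f = a^m be
    handled with th = da. *)
Lemma codiff_fscale k f c th al : is_smooth_function f ->
  ext_d (form_of_fun f) = fscale c th -> is_form k al ->
  codiff L (fscale f al) = fscale f (codiff L al) + fscale c (contr_vf (sharp L th) al).
Proof.
move=> sf df fal; have [_ mal _ sal] := fal; have [_ mL aL _] := bivectorP L.
have sI := smooth_contr_bv (bivectorP L) fal.
rewrite /codiff ext_d_fscale // df wedge1_fscalel contr_bvD !contr_bv_fscale.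
rewrite contr_bv_wedge1 // ext_d_fscale // df wedge1_fscalel.
by apply/funext => p; apply/funext => s; rewrite !form_fieldE; ring.
Qed.

(** Solving [contr_bv_wedge1] for the contraction gives its smoothness without a coordinate
    expression of the field [sharp L th]. *)
Lemma rep_smooth_contr_sharp k th al : is_form 1 th -> is_form k al ->
  rep_smooth (contr_vf (sharp L th) al).
Proof.
move=> fth fal; have [_ _ _ sth] := fth; have [_ mal _ sal] := fal.
have [_ mL aL _] := bivectorP L.
have -> : contr_vf (sharp L th) al =
    contr_bv L (wedge1 th al) + -1 *: wedge1 th (contr_bv L al).
  by rewrite contr_bv_wedge1 // scaleN1r addrAC subrr add0r.
apply: rep_smoothD.
  exact: smooth_contr_bv (bivectorP L) (is_form_wedge1 fth fal).
apply: rep_smoothZ; apply: rep_smooth_wedge1 => //.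
exact: smooth_contr_bv (bivectorP L) fal.
Qed.

(** Moving i(L) past df leaves a contraction with the sharp of df once before and once after d; by
    Cartan's formula the two make up the Lie derivative. Moving d past df gives the sign of the
    first term. *)
Lemma codiff_wedge1 k f al : is_smooth_function f -> is_form k al ->
  let df := ext_d (form_of_fun f) in
  codiff L (wedge1 df al) = - wedge1 df (codiff L al) - lie_d (sharp L df) al.
Proof.
move=> sf fal df; have [_ mal _ sal] := fal; have [_ mL aL _] := bivectorP L.
have fdf := is_form_d_fun sf; have [_ _ _ sdf] := fdf.
have sI := smooth_contr_bv (bivectorP L) fal.
rewrite /codiff /lie_d ext_d_wedge1 // contr_bvN !contr_bv_wedge1 //; last first.
  exact: ext_d_multilinear.
rewrite ext_dD; first last.
- exact: rep_smooth_contr_sharp fdf fal.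
- exact: rep_smooth_wedge1.
rewrite ext_d_wedge1 // wedge1D wedge1N.
by apply/funext => p; apply/funext => s; rewrite !form_fieldE; ring.
Qed.

Lemma codiff_conformal k f al : is_smooth_function f -> is_form k al ->
  codiff (conformal_bv f L) al =
  fscale f (codiff L al) - wedge1 (ext_d (form_of_fun f)) (contr_bv L al).
Proof.
move=> sf fal; have sI := smooth_contr_bv (bivectorP L) fal.
rewrite /codiff !contr_conformal_bv ext_d_fscale //.
by apply/funext => p; apply/funext => s; rewrite !form_fieldE; ring.
Qed.

Lemma d_fun_sharp f p : is_smooth_function f ->
  let df := ext_d (form_of_fun f) in df p [:: sharp L df p] = 0.
Proof.
move=> sf df; have [_ mdf _ _] := is_form_d_fun sf; have [_ mL aL _] := bivectorP L.
by rewrite sharpP //; exact: (aL p [::] [::] [::]).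
Qed.

Lemma contr_sharp_wedge1 f al : is_smooth_function f ->
  let df := ext_d (form_of_fun f) in
  contr_vf (sharp L df) (wedge1 df al) = - wedge1 df (contr_vf (sharp L df) al).
Proof.
move=> sf df; rewrite contr_vf_wedge1 -[RHS]add0r; congr (_ + _).
by apply/funext => p; apply/funext => s; rewrite fscaleE /df d_fun_sharp // mul0r.
Qed.

Lemma contr_conformal_vf f (E : M -> 'rV[R]_n) al : (forall p, multilinear (al p)) ->
  contr_vf (conformal_vf f L E) al =
  contr_vf (sharp L (ext_d (form_of_fun f))) al + fscale f (contr_vf E al).
Proof.
move=> mal; apply/funext => p; apply/funext => s; rewrite form_fieldD fscaleE.
rewrite /contr_vf /conformal_vf addrC (mal p [::] s) addrC; congr (_ + _).
Qed.

End Codifferential.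

(** * Integer powers of the conformal factor *)

Section PowersOfFunction.
Context {R : realType} {n : nat} {M : manifold R n}.
Variables (a : smooth_function M) (a_neq0 : forall p, a p != 0).

Definition funpow (m : int) : M -> R := fun p => a p ^ m.

Lemma smooth_funpow m : is_smooth_function (funpow m).
Proof.
move=> i; apply: (@smooth_exprz _ _ _ (a \o chart_param (atlas i))).
- exact: cod_open.
- by move=> x _; exact: a_neq0.
- exact: smooth_functionP.
Qed.

Lemma d_funpow m : ext_d (form_of_fun (funpow m)) =
  fscale (fun p => m%:~R * funpow (m - 1) p) (ext_d (form_of_fun a)).
Proof.
apply/funext => p; apply/funext => s; rewrite fscaleE !ext_dE -altsumZ.
(* When the remaining list is nonempty both 0-forms are constantly zero along the chart, so both
   derivatives vanish. *)
apply: eq_altsum => w [|v t]; last by rewrite !derive_cst mulr0.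
have pK : chart_param (atlas (base p)) (at_base p) = p by apply: coordK; exact: base_dom.
have := @derive_exprz _ _ (a \o chart_param (atlas (base p))) m (at_base p) w.
rewrite /= pK => <- //.
apply/diff_derivable/(smooth_differentiable (smooth_functionP a _)).
exact: cod_coord (base_dom p).
Qed.

End PowersOfFunction.

(** * The chain isomorphism *)

Section ConformalChainMap.
Context {R : realType} {n : nat} {M : manifold R n}.
Variables (a : smooth_function M) (L : bivector M) (E : vector_field M).
Implicit Types (al be : form_field M) (k m : int) (p : M).
Hypothesis a_neq0 : forall p, a p != 0.

Local Notation da := (ext_d (form_of_fun a)).
Local Notation W := (wedge1 da).
Local Notation S := (contr_vf (sharp L da)).
Local Notation La := (conformal_bivector a L).
Local Notation Ea := (conformal_vector a L E).
Local Notation sp := (smooth_funpow a_neq0).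

(** The factor a of the new bivector raises the coefficient m a^(m-1) of d(a^m) to m a^m, so the
    contraction term carries the same power of a as the wedge term. *)
Lemma codiff_conformal_funpow k m al : is_form k al ->
  codiff La (fscale (funpow a m) al) =
  fscale a (fscale (funpow a m) (codiff L al))
  + fscale (fun p => m%:~R * funpow a m p) (S al)
  - fscale (funpow a m) (W (contr_bv L al)).
Proof.
move=> fal; have fmal := is_form_fscale (sp m) fal; have sa := smooth_functionP a.
rewrite (codiff_conformal _ sa fmal) (codiff_fscale L (sp m) (d_funpow a_neq0 m) fal).
rewrite contr_bv_fscale wedge1_fscale.
apply/funext => p; apply/funext => s; rewrite !form_fieldE.
have -> : funpow a m p = a p * funpow a (m - 1) p.
  by rewrite /funpow -{2}[a p]expr1z -expfzDr // addrC subrK.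
ring.
Qed.

Definition conformal_map (k : int) (c : form_field M * form_field M) :
    form_field M * form_field M :=
  (fscale (funpow a (- k)) c.1 + (-1) ^ k *: fscale (funpow a (- k - 1)) (W c.2),
   fscale (funpow a (- k)) c.2).

(** The map is triangular, so its inverse has the opposite off-diagonal sign, with the power a^k
    a^(-k-1) a^k = a^(k-1). *)
Definition conformal_map_inv (k : int) (c : form_field M * form_field M) :
    form_field M * form_field M :=
  (fscale (funpow a k) c.1 - (-1) ^ k *: fscale (funpow a (k - 1)) (W c.2),
   fscale (funpow a k) c.2).

Lemma funpowD m1 m2 p : funpow a (m1 + m2) p = funpow a m1 p * funpow a m2 p.
Proof. exact: expfzDr. Qed.

Lemma funpow1 p : funpow a 1 p = a p. Proof. exact: expr1z. Qed.

Lemma conformal_mapK k : cancel (conformal_map k) (conformal_map_inv k).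
Proof.
case=> al be; rewrite /conformal_map /conformal_map_inv /= wedge1_fscale.
congr pair; apply/funext => p; apply/funext => s; rewrite !form_fieldE.
  have kk : funpow a k p * funpow a (- k) p = 1 by rewrite -funpowD subrr.
  by rewrite !funpowD; ring: kk.
by rewrite mulrA -funpowD subrr mul1r.
Qed.

Lemma conformal_map_invK k : cancel (conformal_map_inv k) (conformal_map k).
Proof.
case=> al be; rewrite /conformal_map /conformal_map_inv /= wedge1_fscale.
congr pair; apply/funext => p; apply/funext => s; rewrite !form_fieldE.
  have kk : funpow a k p * funpow a (- k) p = 1 by rewrite -funpowD subrr.
  by rewrite !funpowD; ring: kk.
by rewrite mulrA -funpowD addNr mul1r.
Qed.

Lemma signz_sqr (k : int) : (-1) ^ k * (-1) ^ k = 1 :> R.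
Proof. by rewrite -expfzMl mulrNN mulr1 exp1rz. Qed.

(** In Cartan's formula the terms da /\ i(#da) be cancel, and the terms da /\ i_E be, with
    coefficients - m and m + 1, leave exactly one. *)
Lemma lie_conformal_funpow k m be : is_form k be ->
  lie_d Ea (fscale (funpow a m) be) =
  fscale (funpow a m) (lie_d (sharp L da) be + fscale a (lie_d E be)
    + W (contr_vf E be)) + fscale (fun p => m%:~R * funpow a m p * da p [:: E p]) be.
Proof.
move=> fbe; have [_ mbe _ sbe] := fbe; have sa := smooth_functionP a.
have fda := is_form_d_fun sa; have [_ _ _ sda] := fda.
have [_ mmbe _ smbe] := is_form_fscale (sp m) fbe.
have sE : rep_smooth (contr_vf E be) by exact: smooth_contr_vf (vector_fieldP E) fbe.
have sS : rep_smooth (S be) by exact: rep_smooth_contr_sharp fda fbe.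
rewrite /lie_d contr_conformal_vf; last exact: ext_d_multilinear.
rewrite contr_conformal_vf //.
rewrite ext_d_fscale ?d_funpow //; last exact: sp.
rewrite wedge1_fscalel.
(* Merging a and a^m into a^(m+1) lets one Leibniz rule differentiate the product; this is the
   source of the coefficient m + 1. *)
have -> : S (fscale (funpow a m) be) + fscale a (contr_vf E (fscale (funpow a m) be)) =
    fscale (funpow a m) (S be) + fscale (funpow a (m + 1)) (contr_vf E be).
  apply/funext => p; apply/funext => s.
  by rewrite !form_fieldE /contr_vf !form_fieldE funpowD funpow1; ring.
rewrite ext_dD; try (apply: rep_smooth_fscale => //; exact: sp).
rewrite !ext_d_fscale ?d_funpow //; try exact: sp.
rewrite !wedge1_fscalel.
rewrite !contr_vfD !contr_vf_fscale contr_sharp_wedge1 // contr_vf_wedge1.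
apply/funext => p; apply/funext => s; rewrite !form_fieldE !addrK !funpowD funpow1.
have ab : a p * funpow a (- 1) p = 1 by rewrite -[a p]funpow1 -funpowD subrr.
by rewrite intrD; ring: ab.
Qed.

Lemma is_formZ k (z : R) al : is_form k al -> is_form k (z *: al).
Proof. by move=> fal; rewrite -[z *: al]addr0; exact: is_form_lin fal (is_form0 _ _). Qed.

Lemma LJ_delta_conformal k c : LJ_chain k c ->
  LJ_delta La Ea k (conformal_map k c) = conformal_map (k - 1) (LJ_delta L E k c).
Proof.
case: c => al be [/= fal fbe]; have sa := smooth_functionP a.
have [_ mal _ _] := fal; have [_ mbe _ _] := fbe.
have fda := is_form_d_fun sa.
have fWbe : is_form k (W be) by rewrite -[k](subrK 1); exact: is_form_wedge1.
have [_ mWbe _ _] := fWbe; have [_ mL aL _] := bivectorP L.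
have codE (K : mv_field M) x :
    contr_bv K (ext_d x) - ext_d (contr_bv K x) = codiff K x by [].
have fal' := is_form_fscale (sp (- k)) fal.
have fWbe' := is_form_fscale (sp (- k - 1)) fWbe.
have pk (p : M) : funpow a (- k) p = a p * funpow a (- k - 1) p.
  by rewrite -[a p]funpow1 -funpowD addrC subrK.
have pk1 (p : M) : funpow a (- (k - 1)) p = a p * funpow a (- k) p.
  by rewrite -[a p]funpow1 -funpowD opprB.
have pk2 (p : M) : funpow a (- (k - 1) - 1) p = funpow a (- k) p.
  by congr funpow; ring.
have ek : (-1) ^ (k - 1) = - (-1) ^ k :> R.
  by rewrite expfzDr ?oppr_eq0 ?oner_eq0 // exprN1 invrN invr1 mulrN1.
rewrite /LJ_delta /conformal_map /= !codE; congr pair; last first.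
  (* Second component: [S be] has coefficient - k from the codifferential and k - 1 from [Ea].
     Contracting the extra summand [W be] of the first component supplies the missing [S be] and
     also cancels - [W (contr_bv L be)]; the two signs (-1)^k multiply to 1. *)
  rewrite (codiff_conformal_funpow _ fbe) contr_vf_fscale contr_conformal_vf //.
  rewrite contr_conformal_bv contr_bvD contr_bvZ !contr_bv_fscale contr_bv_wedge1 //.
  apply/funext => p; apply/funext => s; rewrite !form_fieldE pk1 pk.
  rewrite !rmorphN !rmorphB /=.
  by ring: (signz_sqr k).
(* First component: the terms [S al] cancel with coefficients - k and k, and the terms [W (S be)]
   with k + 1, - 1 and - k. The Lie derivatives along the sharp of da cancel, as do the terms da(E)
   be. The terms [W (contr_vf E be)] add up to 1 - k, as the degree k - 1 map requires. *)
rewrite (codiffD La fal' (is_formZ _ fWbe')) (codiffZ La _ fWbe').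
rewrite (codiff_conformal_funpow _ fal) (codiff_conformal_funpow _ fWbe).
have WI : W (contr_bv L (W be)) = W (S be).
  by rewrite contr_bv_wedge1 // wedge1D wedge1_wedge1 add0r.
have Wlin (y z : R) x1 x2 x3 :
    W (x1 + y *: x2 + z *: x3) = W x1 + y *: W x2 + z *: W x3.
  by rewrite !wedge1D !wedge1Z.
rewrite (codiff_wedge1 L sa fbe) WI Wlin.
rewrite (lie_conformal_funpow _ fbe) contr_vfD contr_vfZ.
rewrite !contr_vf_fscale !contr_conformal_vf //.
rewrite contr_sharp_wedge1 // contr_vf_wedge1.
apply/funext => p; apply/funext => s; rewrite !form_fieldE pk2 pk1 !pk ek.
rewrite !rmorphB !rmorphN /=.
by ring: (signz_sqr k).
Qed.

End ConformalChainMap.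

(** * Passage to homology *)

Section QuotientIsomorphism.
Context {R : pzRingType} {V W : lmodType R} {S : {pred V}} {T : {pred W}}.
Variables (S_closed : submod_closed S) (T_closed : submod_closed T).
Local Open Scope quotient_scope.

Lemma lmod_quot_eq v w : v - w \in S ->
  \pi_(lmod_quot S_closed) v = \pi_(lmod_quot S_closed) w.
Proof. by move=> vw; apply/eqP; rewrite -Quotient.idealrBE. Qed.

Lemma lmod_quot_repr v : repr (\pi_(lmod_quot S_closed) v) - v \in S.
Proof.
have : repr (\pi_(lmod_quot S_closed) v) - v \in submod_of S_closed.
  by rewrite Quotient.idealrBE reprK.
by [].
Qed.

End QuotientIsomorphism.

(** The bijection identifies S with T, so it descends to the quotients in both directions; the
    induced maps are defined on chosen representatives. *)
Lemma lmod_quot_isomorphic (R : pzRingType) (V W : lmodType R)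
    (S : {pred V}) (T : {pred W})
    (S_closed : submod_closed S) (T_closed : submod_closed T)
    (f : {linear V -> W}) (g : W -> V) :
  cancel f g -> cancel g f ->
  (forall v, v \in S -> f v \in T) -> (forall w, w \in T -> g w \in S) ->
  lmod_isomorphic (lmod_quot S_closed) (lmod_quot T_closed).
Proof.
move=> fK gK fS gT.
(* Compatibility of g with differences is inherited from f through injectivity; it makes the map
   induced by g independent of representatives. *)
have gB : {morph g : x y / x - y} by move=> x y; apply: (can_inj fK); rewrite linearB !gK.
pose F (x : lmod_quot S_closed) : lmod_quot T_closed :=
  \pi_(lmod_quot T_closed)%qT (f (repr x)).
pose G (y : lmod_quot T_closed) : lmod_quot S_closed :=
  \pi_(lmod_quot S_closed)%qT (g (repr y)).
have Fpi v : F (\pi_(lmod_quot S_closed)%qT v) = \pi_(lmod_quot T_closed)%qT (f v).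
  by apply: lmod_quot_eq; rewrite -linearB fS // lmod_quot_repr.
have Gpi w : G (\pi_(lmod_quot T_closed)%qT w) = \pi_(lmod_quot S_closed)%qT (g w).
  by apply: lmod_quot_eq; rewrite -gB gT // lmod_quot_repr.
have Flin : linear F.
  move=> c x y; rewrite -[x]reprK -[y]reprK -linearP !Fpi.
  by rewrite -linearP; congr (\pi__ _)%qT; rewrite linearP.
pose Flin' := GRing.isLinear.Build _ _ _ _ F Flin.
pose FL : {linear _ -> _} := HB.pack F Flin'.
exists FL; exists G => [x|y] /=.
  by rewrite -[x]reprK Fpi Gpi fK.
by rewrite -[y]reprK Gpi Fpi gK.
Qed.

(** * Conformal invariance of the homology *)

Section ConformalInvariance.
Context {R : realType} {n : nat} {M : manifold R n}.
Variables (a : smooth_function M) (L : bivector M) (E : vector_field M) (k : int).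
Hypothesis a_neq0 : forall p, a p != 0.

Local Notation La := (conformal_bivector a L).
Local Notation Ea := (conformal_vector a L E).
Local Notation sp := (smooth_funpow a_neq0).

Lemma conformal_map_lin m c x y :
  conformal_map a m (c *: x + y) = c *: conformal_map a m x + conformal_map a m y.
Proof.
case: x y => [x1 x2] [y1 y2]; rewrite /conformal_map /= wedge1_lin.
by congr pair; apply/funext => p; apply/funext => s; rewrite /= !form_fieldE; ring.
Qed.

Lemma conformal_map_chain m c : LJ_chain m c -> LJ_chain m (conformal_map a m c).
Proof.
move=> [fc1 fc2]; have fda := is_form_d_fun (smooth_functionP a).
split => /=; last exact: is_form_fscale (sp _) fc2.
rewrite addrC; apply: is_form_lin; apply: is_form_fscale => //; try exact: sp.
by rewrite -[m](subrK 1); exact: is_form_wedge1.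
Qed.

Lemma conformal_map_inv_chain m c : LJ_chain m c -> LJ_chain m (conformal_map_inv a m c).
Proof.
move=> [fc1 fc2]; have fda := is_form_d_fun (smooth_functionP a).
split => /=; last exact: is_form_fscale (sp _) fc2.
rewrite addrC -scaleNr; apply: is_form_lin; apply: is_form_fscale => //; try exact: sp.
by rewrite -[m](subrK 1); exact: is_form_wedge1.
Qed.

Lemma LJ_delta_conformal_inv m c : LJ_chain m c ->
  LJ_delta L E m (conformal_map_inv a m c) =
  conformal_map_inv a (m - 1) (LJ_delta La Ea m c).
Proof.
move=> cc; rewrite -[c in RHS](conformal_map_invK a_neq0 m).
rewrite (LJ_delta_conformal _ _ a_neq0 (conformal_map_inv_chain cc)).
by rewrite (conformal_mapK a_neq0).
Qed.

Lemma conformal_map0 m : conformal_map a m 0 = 0.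
Proof.
have := conformal_map_lin m (-1) 0 0.
by rewrite scaleN1r oppr0 addr0 scaleN1r addNr.
Qed.

Lemma conformal_map_inv0 m : conformal_map_inv a m 0 = 0.
Proof. by rewrite -(conformal_map0 m) (conformal_mapK a_neq0) conformal_map0. Qed.

Lemma conformal_map_cycle c :
  c \in LJ_cycles L E k -> conformal_map a k c \in LJ_cycles La Ea k.
Proof.
move=> /asboolP[cc dc]; apply/asboolP; split; first exact: conformal_map_chain.
by rewrite (LJ_delta_conformal _ _ a_neq0 cc) dc conformal_map0.
Qed.

Lemma conformal_map_inv_cycle c :
  c \in LJ_cycles La Ea k -> conformal_map_inv a k c \in LJ_cycles L E k.
Proof.
move=> /asboolP[cc dc]; apply/asboolP; split; first exact: conformal_map_inv_chain.
by rewrite (LJ_delta_conformal_inv cc) dc conformal_map_inv0.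
Qed.

Lemma LJ_homology_conformal :
  lmod_isomorphic (LJ_homology L E k) (LJ_homology La Ea k).
Proof.
pose f (z : LJ_cycle L E k) : LJ_cycle La Ea k :=
  LJCycle (conformal_map_cycle (cycle_valP z)).
pose g (z : LJ_cycle La Ea k) : LJ_cycle L E k :=
  LJCycle (conformal_map_inv_cycle (cycle_valP z)).
have flin : linear f.
  move=> c x y; apply: val_inj; rewrite linearP /=; exact: conformal_map_lin.
pose flin' := GRing.isLinear.Build _ _ _ _ f flin.
pose fL : {linear _ -> _} := HB.pack f flin'.
apply: (@lmod_quot_isomorphic _ _ _ _ _ _ _ fL g) => [x|y|z|z].
- by apply: val_inj; exact: conformal_mapK.
- by apply: val_inj; exact: conformal_map_invK.
(* A chain bounding a cycle has degree k + 1, so it is transported by the map of that degree; its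
   delta is then transported by the map of degree k + 1 - 1 = k. *)
- move=> /asboolP[c cc dc]; apply/asboolP.
  exists (conformal_map a (k + 1) c); first exact: conformal_map_chain.
  by rewrite (LJ_delta_conformal _ _ a_neq0 cc) dc addrK.
- move=> /asboolP[c cc dc]; apply/asboolP.
  exists (conformal_map_inv a (k + 1) c); first exact: conformal_map_inv_chain.
  by rewrite (LJ_delta_conformal_inv cc) dc addrK.
Qed.

End ConformalInvariance.

Theorem theorem4p7 (R : realType) (n : nat) (M : manifold R n)
    (L : bivector M) (E : vector_field M) (a : smooth_function M)
    (jacobi_LE : is_jacobi L E) (a_pos : forall p : M, 0 < a p) (k : int) :
  lmod_isomorphic
    (LJ_homology L E k)
    (LJ_homology (conformal_bivector a L) (conformal_vector a L E) k).
Proof.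
apply: LJ_homology_conformal => p; exact: lt0r_neq0 (a_pos p).
Qed.
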